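(* Let $n\ge2$. On the strictly hyperbolic region define, for $i=1,\dots,n$, the functions $$G_i=-\tfrac12\log|u_{r_i}|=\tfrac12\log|F_{pp}(\lambda_i)| .$$ Then for all $j\neq i$, $$\partial_{r_j}G_i=-\frac{u_{r_ir_j}}{2u_{r_i}}=-\frac{u_{r_j}}{(\lambda_i-\lambda_j)^2}=\frac{(\lambda_i)_{r_j}}{\lambda_i-\lambda_j}.$$
   Context: For $(u_1,\dots,u_n)\in\mathbb{R}^n$ put $F(p)=\frac{1}{n+1}p^{n+1}+u_1p^{n-1}+u_2p^{n-2}+\dots+u_{n-1}p+u_n$ (no $p^n$ term), and write $u=u_1$. The strictly hyperbolic region is the open set of $(u_1,\dots,u_n)\in\mathbb{R}^n$ for which $F_p=\partial F/\partial p$ has $n$ distinct real roots $\lambda_1<\dots<\lambda_n$. Put $r_i=F(\lambda_i)$, the critical values. By a classical theorem of MacLane, $(u_1,\dots,u_n)\mapsto(r_1,\dots,r_n)$ is a diffeomorphism from the strictly hyperbolic region onto an open subset of $\mathbb{R}^n$, so $(r_1,\dots,r_n)$ are global coordinates there, and $u$, $\lambda_i$, $F_{pp}(\lambda_i)$ are regarded as functions of $(r_1,\dots,r_n)$; subscripts $r_i$ and $\partial_{r_i}$ denote partial derivatives in these coordinates, and $F_{pp}(\lambda_i)$ is the second $p$-derivative of $F$ at $p=\lambda_i$. One has $F_{pp}(\lambda_i)u_{r_i}=1$, so the two expressions for $G_i$ agree. *)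

(* Defs.v *)
From HB Require Import structures.
From mathcomp Require Import all_boot all_order all_algebra.
From mathcomp Require Import all_classical all_reals all_analysis.

Set Implicit Arguments.
Unset Strict Implicit.
Unset Printing Implicit Defensive.

Import Order.TTheory GRing.Theory Num.Theory.
Import numFieldNormedType.Exports.

Local Open Scope classical_set_scope.
Local Open Scope ring_scope.

Section StrictlyHyperbolic.
Variables (R : realType) (n : nat).
Implicit Types (u r l : 'rV[R]_n) (i j : 'I_n).

(* Coordinates are numbered from 0, so that the entry [u 0 k] is the
   coefficient u_(k+1), which multiplies p^(n-1-k). *)
Definition F u : {poly R} :=
  (n.+1%:R)^-1 *: 'X^(n.+1) + \sum_(k < n) u 0 k *: 'X^(n.-1 - k).

Definition Fp u : {poly R} := (F u)^`().

Definition Fpp u : {poly R} := (F u)^`(2).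

(* [Fp u] has degree n, hence [l] lists all of its complex roots. *)
Definition ordered_roots u l :=
  (forall i j, (i < j)%N -> l 0 i < l 0 j) /\ (forall i, root (Fp u) (l 0 i)).

Definition hyperbolic : set 'rV[R]_n := [set u | exists l, ordered_roots u l].

(* Outside [hyperbolic] the value is the junk vector 0; on [hyperbolic] the
   vector satisfying [ordered_roots u] is unique. *)
Definition lambda i u : R := (xget 0 [set l | ordered_roots u l]) 0 i.

Definition critval u : 'rV[R]_n := \row_i (F u).[lambda i u].

(* MacLane: [critval] is a diffeomorphism from [hyperbolic] onto an open set;
   this is its inverse (arbitrary off the image). *)
Definition of_critval : 'rV[R]_n -> 'rV[R]_n :=
  'pinv_(fun=> 0) hyperbolic critval.

(* A function [f] on [hyperbolic] is regarded as a function of the coordinates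
   r = critval u by composing it with [of_critval]; [pdr j f] is its partial
   derivative with respect to r_j, again viewed as a function of u. *)
Definition pdr j (f : 'rV[R]_n -> R) u : R :=
  'D_(delta_mx 0 j) (f \o of_critval : 'rV[R]_n -> R^o) (critval u).

(* [pdr] is a total operator, so existence is recorded separately. *)
Definition pdr_exists j (f : 'rV[R]_n -> R) u : Prop :=
  derivable (f \o of_critval : 'rV[R]_n -> R^o) (critval u) (delta_mx 0 j).

Definition coord1 (n_gt0 : (0 < n)%N) u : R := u 0 (Ordinal n_gt0).

Definition G (n_gt0 : (0 < n)%N) i u : R :=
  - (2^-1 * ln `|pdr i (coord1 n_gt0) u|).

End StrictlyHyperbolic.

(* Main.v *)
Require Import Defs.
From HB Require Import structures.
From mathcomp Require Import all_boot all_order all_algebra.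
From mathcomp Require Import all_classical all_reals all_analysis.
From mathcomp Require Import polyrcf zify ring lra.

(** Write [l_k] for the critical points of [F] and [r_k] for the critical values.
    Only the coefficients of degree less than [n] of [F] vary, so a variation of
    the point [u] is a polynomial [q] of degree less than [n].  Since [F'] vanishes at
    [l_k], the critical value [r_k] varies by [q(l_k)].  Along the coordinate
    line of [r_j] this is 1 for [k = j] and 0 otherwise, and Lagrange
    interpolation gives [q = Q / F_pp(l_j)], where [Q] is the product of the
    [X - l_k] for [k <> j] ([lower_lagrange]).  The coefficient of degree [n-1]
    of [q] is the derivative of [u_1] ([is_derive_coord1]).  Differentiating
    [F'(l_i) = 0] shows that [l_i] varies by [- q'(l_i) / F_pp(l_i)]
    ([is_derive_lambda]), and [F_pp(l_i)] then varies by
    [q''(l_i) + F_ppp(l_i) l_i'] ([is_derive_Fpp]).  With [F' = (X - l_j) Q] all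
    of these become rational expressions in [F_pp(l_i)], [F_pp(l_j)] and
    [l_i - l_j], and the asserted equalities are identities between them.

    This presupposes the part of MacLane's theorem that makes the [r_k]
    coordinates: the map from [u] to the critical values is injective on the
    whole hyperbolic region ([critval_inj]), and its inverse is defined and
    continuous near each of its values ([near_of_critval]).  Both are read off
    from a square system in the [2n] unknowns [(u, l)]: the equations
    [F'(l_k) = 0], the value [F(l_0)], and the quantities

      [t |F(l_k) - F(l_(k-1))| + (1 - t) (l_k - l_(k-1))]     for [k > 0],

    where [t = 1] is the problem of interest and [t = 0] prescribes the gaps.

    For every [t] in [[0,1]] the linearized system is injective
    ([linearized_kernel]): for [t > 0] a variation [q] in its kernel would have a
    zero of [q'] inside each of the [n-1] gaps, but [q'] has degree at most [n-2].
    Hence Newton's method continues any solution to nearby parameters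
    ([solvable_near], [near_solution]).  The equations bound the gaps from above
    ([root_le_bound]) and from below ([gap_lb]), so solutions stay in a compact
    set.  For [t = 0] there is only one solution, because the roots of [F'] have
    sum 0 ([solution0_uniq]).  If there were two solutions for [t = 1], there
    would be a least [t] with two solutions; it would be positive, and continuing
    both solutions to a smaller [t] would contradict its choice
    ([solution_uniq]).  That the least [t] exists needs that two solutions cannot
    merge in the limit; this is why the compact set [chords] also records the
    direction of the chord that joins them. *)

Import Order.TTheory GRing.Theory Num.Theory.
Import numFieldNormedType.Exports.

Local Open Scope classical_set_scope.
Local Open Scope ring_scope.

Set Implicit Arguments.
Unset Strict Implicit.
Unset Printing Implicit Defensive.

(** * Divided differences of polynomials *)

Section Secant.
Variable R : comNzRingType.
Implicit Types (p : {poly R}) (a b : R).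

(** Divided difference of [p] at [a] and [b], for [size p <= N].  Being a polynomial
    in [a], [b] and the coefficients, it remains continuous where [a = b]. *)
Definition secant N p a b : R :=
  \sum_(i < N) p`_i * \sum_(j < i) a ^+ (i.-1 - j) * b ^+ j.

Lemma secantP N p a b : (size p <= N)%N ->
  p.[a] - p.[b] = (a - b) * secant N p a b.
Proof.
move=> sp; rewrite !(horner_coef_wide _ sp) -sumrB /secant mulr_sumr.
by apply: eq_bigr => i _; rewrite mulrCA -subrXX mulrBr.
Qed.

Lemma size_deriv_le p : (size p^`() <= (size p).-1)%N.
Proof.
have [->|] := eqVneq p 0; first by rewrite linear0 size_poly0.
by move=> p0; rewrite -ltnS prednK ?size_poly_gt0 // lt_size_deriv.
Qed.

Lemma secant_diag N p a : (size p <= N)%N -> secant N p a a = p^`().[a].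
Proof.
case: N => [|N] sp.
  by move: sp; rewrite leqn0 size_poly_eq0 => /eqP->; rewrite /secant big_ord0 linear0 horner0.
have sdp : (size p^`() <= N)%N.
  by rewrite (leq_trans (size_deriv_le p)) //; move: sp; case: (size p).
rewrite (horner_coef_wide _ sdp) /secant.
rewrite big_ord_recl /= big_ord0 mulr0 add0r; apply: eq_bigr => i _.
rewrite coef_deriv /bump /= add1n /= -[in RHS]mulr_natr -mulrA; congr (_ * _).
rewrite (eq_bigr (fun=> a ^+ i)) ?sumr_const ?card_ord ?mulr_natl // => j _.
by rewrite -exprD subnK // -ltnS.
Qed.

End Secant.

(** * The family [F] and its coefficients *)

Section Family.
Variables (R : realType) (n : nat).
Implicit Types (u v w l : 'rV[R]_n) (i j k : 'I_n).

Definition lower u : {poly R} := \sum_(k < n) u 0 k *: 'X^(n.-1 - k).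

Lemma FE u : F u = (n.+1%:R)^-1 *: 'X^(n.+1) + lower u.
Proof. by []. Qed.

Lemma lowerB u v : lower (u - v) = lower u - lower v.
Proof. by rewrite -sumrB; apply: eq_bigr => k _; rewrite !mxE scalerBl. Qed.

Lemma lowerZ c u : lower (c *: u) = c *: lower u.
Proof. by rewrite scaler_sumr; apply: eq_bigr => k _; rewrite !mxE scalerA. Qed.

Lemma lowerD u v : lower (u + v) = lower u + lower v.
Proof. by rewrite -big_split; apply: eq_bigr => k _; rewrite !mxE scalerDl. Qed.

Lemma FB u v : F u - F v = lower (u - v).
Proof. by rewrite !FE lowerB opprD addrACA subrr add0r. Qed.

Lemma coef_lower u m : (lower u)`_m = \sum_(k < n) u 0 k * (m == (n.-1 - k)%N)%:R.
Proof. by rewrite coef_sum; apply: eq_bigr => k _; rewrite coefZ coefXn. Qed.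

Lemma coef_lower_rev u k : (lower u)`_(n.-1 - k) = u 0 k.
Proof.
rewrite coef_lower (bigD1 k) //= eqxx mulr1 big1 ?addr0 // => j jk.
rewrite (_ : (_ == _) = false) ?mulr0 //; apply: contraNF jk => /eqP e.
by apply/eqP/val_inj; have := ltn_ord k; have := ltn_ord j; move: e => /=; lia.
Qed.

Lemma size_lower u : (size (lower u) <= n)%N.
Proof.
apply/leq_sizeP => m nm; rewrite coef_lower big1 // => k _.
rewrite (_ : (_ == _) = false) ?mulr0 //; apply/eqP.
by have := ltn_ord k; lia.
Qed.

Lemma lower_inj u : lower u = 0 -> u = 0.
Proof. by move=> u0; apply/rowP => k; rewrite mxE -coef_lower_rev u0 coef0. Qed.

Lemma size_F u : size (F u) = n.+2.
Proof.
rewrite FE size_polyDl; rewrite size_scale ?size_polyXn ?invr_eq0 ?pnatr_eq0 //.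
by apply: leq_ltn_trans (size_lower u) _; rewrite ltnS.
Qed.

Lemma FpE u : Fp u = 'X^n + (lower u)^`().
Proof.
rewrite /Fp FE derivD derivZ derivXn /= -scalerMnr scalerMnl -mulr_natr.
by rewrite mulVf ?pnatr_eq0 // scale1r.
Qed.

Lemma size_deriv_lower u : (size (lower u)^`() <= n.-1)%N.
Proof.
apply: leq_trans (size_deriv_le _) _.
by have := size_lower u; case: (size _) n => [|m] [|n'].
Qed.

Lemma size_Fp u : size (Fp u) = n.+1.
Proof.
rewrite FpE size_polyDl ?size_polyXn //.
by rewrite ltnS (leq_trans (size_deriv_lower u)) ?leq_pred.
Qed.

Lemma monic_Fp u : lead_coef (Fp u) = 1.
Proof.
rewrite FpE lead_coefDl ?lead_coefXn // size_polyXn ltnS.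
by rewrite (leq_trans (size_deriv_lower u)) ?leq_pred.
Qed.

Lemma coef_Fp_pred u : (0 < n)%N -> (Fp u)`_n.-1 = 0.
Proof.
move=> n0; rewrite FpE coefD coefXn [(_^`())`_ _]nth_default ?size_deriv_lower //.
by rewrite ltn_eqF ?addr0 // prednK.
Qed.

Lemma FppE u : Fpp u = (Fp u)^`().
Proof. by rewrite /Fpp derivnS derivn1. Qed.

End Family.

(** * Critical points and the signs between them *)

Section Roots.
Variables (R : realType) (n : nat).
Implicit Types (u v w l : 'rV[R]_n) (i j k : 'I_n).

Definition increasing l := forall i j, (i < j)%N -> l 0 i < l 0 j.

Lemma increasing_inj l : increasing l -> injective (l 0).
Proof.
move=> il i j e; apply/val_inj/eqP; case: ltngtP => // /il;
by rewrite e ltxx.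
Qed.

Lemma increasing_le l : increasing l -> forall i j, (i <= j)%N -> l 0 i <= l 0 j.
Proof.
move=> il i j; rewrite leq_eqVlt => /predU1P[/val_inj ->//|/il/ltW//].
Qed.

Definition row_seq l : seq R := [seq l 0 i | i <- enum 'I_n].

Lemma big_row_seq (T : Type) (idx : T) (op : T -> T -> T) (f : R -> T) l :
  \big[op/idx]_(x <- row_seq l) f x = \big[op/idx]_(k < n) f (l 0 k).
Proof. by rewrite big_map enumT. Qed.

Lemma size_row_seq l : size (row_seq l) = n.
Proof. by rewrite size_map size_enum_ord. Qed.

Lemma uniq_row_seq l : increasing l -> uniq (row_seq l).
Proof. by move=> il; rewrite map_inj_uniq ?enum_uniq //; exact: increasing_inj. Qed.

Lemma poly_eq0_increasing (p : {poly R}) l : increasing l ->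
  (forall k, p.[l 0 k] = 0) -> (size p <= n)%N -> p = 0.
Proof.
move=> il rp sp; apply: (roots_geq_poly_eq0 _ (uniq_row_seq il)); last by rewrite size_row_seq.
by apply/allP => _ /mapP[k _ ->]; apply/rootP.
Qed.

(** [F'] is monic of degree [n], so [n] distinct roots exhaust it. *)
Lemma Fp_prod u l : ordered_roots u l -> Fp u = \prod_(k < n) ('X - (l 0 k)%:P).
Proof.
case=> il rl; have := @all_roots_prod_XsubC _ (Fp u) (row_seq l).
rewrite size_row_seq size_Fp monic_Fp scale1r uniq_rootsE uniq_row_seq //.
rewrite big_row_seq => -> //.
by apply/allP => _ /mapP[k _ ->].
Qed.

Lemma ordered_roots_uniq u l l' : ordered_roots u l -> ordered_roots u l' -> l = l'.
Proof.
have srt t : increasing t -> sorted <%R (row_seq t).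
  move=> it; rewrite /row_seq sorted_map.
  have : sorted ltn [seq val i | i <- enum 'I_n] by rewrite val_enum_ord iota_ltn_sorted.
  by rewrite sorted_map; apply: sub_sorted => i j; exact: it.
move=> H H'; have := Fp_prod H; rewrite (Fp_prod H') => e.
have: row_seq l = row_seq l'.
  apply: (irr_sorted_eq lt_trans (@ltxx _ _)); [exact: srt (H.1)|exact: srt (H'.1)|].
  move=> x; by rewrite -!root_prod_XsubC !big_row_seq e.
move=> es; apply/rowP => k.
have /eq_in_map/(_ k) := es; apply; by rewrite mem_enum.
Qed.

(** The sum is minus the coefficient of [p^(n-1)] in [F'], and [F] has no term in
    [p^n]. *)
Lemma sum_roots u l : (0 < n)%N -> ordered_roots u l -> \sum_k l 0 k = 0.
Proof.
move=> n0 H; have := coef_Fp_pred u n0.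
have := @coefPn_prod_XsubC _ (row_seq l); rewrite size_row_seq -lt0n => /(_ n0).
rewrite !big_row_seq -(Fp_prod H) => -> /eqP.
by rewrite oppr_eq0 => /eqP.
Qed.

Lemma lambdaP u l : ordered_roots u l -> forall k, lambda k u = l 0 k.
Proof.
move=> H k; rewrite /lambda; case: xgetP => [l' _ H'|/(_ l)//].
by rewrite (ordered_roots_uniq H H').
Qed.

Lemma Fpp_root u l k : ordered_roots u l ->
  (Fpp u).[l 0 k] = \prod_(j < n | j != k) (l 0 k - l 0 j).
Proof.
move=> H; rewrite FppE (Fp_prod H) (bigD1 k) //= derivM derivXsubC mul1r.
rewrite hornerD hornerM hornerXsubC subrr mul0r addr0 horner_prod.
by apply: eq_bigr => j _; rewrite hornerXsubC.
Qed.

Lemma Fpp_root_neq0 u l k : ordered_roots u l -> (Fpp u).[l 0 k] != 0.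
Proof.
move=> H; rewrite (Fpp_root _ H); apply/prodf_neq0 => j jk.
by rewrite subr_eq0; apply: contraNneq jk => /(increasing_inj H.1) ->.
Qed.

(** The predecessor of [k], with 0 sent to itself: the gaps between consecutive
    roots are indexed by the [k > 0], gap [k] reaching from [l_(k-1)] to [l_k]. *)
Definition prv k : 'I_n := Ordinal (leq_ltn_trans (leq_pred k) (ltn_ord k)).

(** The sign of [F'] on gap [k]: each factor [X - l_j] with [j >= k] is negative
    there. *)
Definition gapsign k : R := \prod_(j < n) (if (j < k)%N then 1 else -1).

Lemma gapsignK k : gapsign k * gapsign k = 1.
Proof.
rewrite /gapsign -big_split /= big1 // => j _; case: ifP; rewrite ?mulr1 //.
by rewrite mulrNN mulr1.
Qed.

Lemma Fp_gap u l k x : ordered_roots u l -> (0 < k)%N ->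
  l 0 (prv k) < x < l 0 k -> gapsign k * (Fp u).[x] = \prod_(j < n) `|x - l 0 j|.
Proof.
move=> H k0 /andP[x1 x2]; rewrite (Fp_prod H) horner_prod /gapsign -big_split /=.
apply: eq_bigr => j _; rewrite hornerXsubC; case: ltnP => jk.
  rewrite mul1r ger0_norm // subr_ge0 (le_trans _ (ltW x1)) //.
  by apply: (increasing_le H.1); rewrite /= -ltnS prednK.
rewrite mulN1r ler0_norm // subr_le0 (le_trans (ltW x2)) //.
exact: (increasing_le H.1).
Qed.

Lemma prv_lt k : (0 < k)%N -> (prv k < k)%N.
Proof. by move=> k0; rewrite /= prednK. Qed.

Lemma Fpp_gap_right u l k : ordered_roots u l -> gapsign k * (Fpp u).[l 0 k] < 0.
Proof.
move=> H; rewrite (Fpp_root _ H) /gapsign (bigD1 k) //= ltnn mulN1r mulNr oppr_lt0.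
rewrite -big_split /=; apply: prodr_gt0 => j jk; case: ltnP => h.
  by rewrite mul1r subr_gt0 H.1.
by rewrite mulN1r opprB subr_gt0 H.1 // ltn_neqAle h andbT eq_sym.
Qed.

Lemma Fpp_gap_left u l k : ordered_roots u l -> (0 < k)%N ->
  0 < gapsign k * (Fpp u).[l 0 (prv k)].
Proof.
move=> H k0; rewrite (Fpp_root _ H) /gapsign (bigD1 (prv k)) //= prv_lt // mul1r.
rewrite -big_split /=; apply: prodr_gt0 => j jk; case: ltnP => h.
  by rewrite mul1r subr_gt0 H.1 //; move: jk h; rewrite -(inj_eq val_inj) /=; lia.
by rewrite mulN1r opprB subr_gt0 H.1 // (leq_trans _ h) // prv_lt.
Qed.

End Roots.

(** * Injectivity of the linearized system *)

Section Kernel.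
Variables (R : realType) (n : nat).
Implicit Types (u v w l : 'rV[R]_n) (i j k : 'I_n).

Lemma prv_ind (P : 'I_n -> Prop) :
  (forall k, k = 0%N :> nat -> P k) ->
  (forall k, (0 < k)%N -> P (prv k) -> P k) -> forall k, P k.
Proof.
move=> P0 PS [m mn]; elim: m mn => [|m IH] mn; first exact: P0.
have mn' : (m < n)%N by apply: ltnW.
by apply: PS => //; have := IH mn'; congr P; apply/val_inj.
Qed.

(** By the mean value theorem the increment of [q] over the gap has the sign of
    some [q'(z)].  If [q'(z)] has the sign of [F'], the gap equation forces
    [a_k < a_(k-1)], so [a_k < 0] or [a_(k-1) > 0].  At that end of the gap the
    sign of [F_pp] is known, and the first family of equations gives [q'] the
    sign opposite to that of [F']; so [q'] vanishes in between.  The other sign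
    of [q'(z)] reduces to this one on replacing [q] and [a] by their opposites. *)
Lemma deriv_root_in_gap u l (t : R) (q : {poly R}) (a : 'I_n -> R) k :
  ordered_roots u l -> 0 < t <= 1 -> (0 < k)%N ->
  (forall j, q^`().[l 0 j] + (Fpp u).[l 0 j] * a j = 0) ->
  t * (gapsign R k * (q.[l 0 k] - q.[l 0 (prv k)])) + (1 - t) * (a k - a (prv k)) = 0 ->
  exists2 x, l 0 (prv k) < x < l 0 k & root q^`() x.
Proof.
move=> H /andP[t0 t1] k0.
have lk : l 0 (prv k) < l 0 k by apply: H.1; exact: prv_lt.
set s := gapsign R k.
(* The case where [p'(z)] has the sign of [F']. *)
suff main (p : {poly R}) (b : 'I_n -> R) z : l 0 (prv k) < z < l 0 k ->
    p.[l 0 k] - p.[l 0 (prv k)] = p^`().[z] * (l 0 k - l 0 (prv k)) ->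
    0 < s * p^`().[z] ->
    (forall j, p^`().[l 0 j] + (Fpp u).[l 0 j] * b j = 0) ->
    t * (s * (p.[l 0 k] - p.[l 0 (prv k)])) + (1 - t) * (b k - b (prv k)) = 0 ->
    exists2 x, l 0 (prv k) < x < l 0 k & root p^`() x.
  move=> Hq E; have [z] := poly_mvt q lk; rewrite in_itv /= => zI mz.
  have [z0|z0|z0] := ltrgtP (s * q^`().[z]) 0; last 1 first.
  - exists z => //; apply/rootP; move/(congr1 ( *%R s)): z0.
    by rewrite mulrA gapsignK mul1r mulr0.
  - have [||||x xI] := main (- q) (fun j => - a j) z zI.
    + by rewrite linearN !hornerN mulNr -mz; ring.
    + by rewrite linearN hornerN mulrN oppr_gt0.
    + by move=> j; rewrite linearN hornerN mulrN -opprD Hq oppr0.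
    + by rewrite !hornerN -[RHS]oppr0 -E; ring.
    by rewrite linearN rootN; exists x.
  - exact: (main q a z).
move=> zI mz z0 Hp E; have /andP[z1 z2] := zI.
have pz (j : 'I_n) : s * p^`().[l 0 j] = - (s * (Fpp u).[l 0 j] * b j).
  by rewrite -mulrA -mulrN; congr (_ * _); apply/eqP; rewrite -addr_eq0 Hp.
have ivt x y : x < y -> (s * p^`().[x]) * (s * p^`().[y]) < 0 ->
    exists2 e, x < e < y & root p^`() e.
  move=> xy; rewrite mulrACA gapsignK mul1r => /(poly_ivtoo (ltW xy))[e].
  by rewrite in_itv /=; exists e.
have D0 : 0 < s * (p.[l 0 k] - p.[l 0 (prv k)]).
  by rewrite mz mulrA mulr_gt0 // subr_gt0.
have bb : (1 - t) * (b k - b (prv k)) < 0.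
  by rewrite -(addKr (t * (s * (p.[l 0 k] - p.[l 0 (prv k)])))
    (_ * _)) E addr0 oppr_lt0 mulr_gt0.
have bb' : b k < b (prv k).
  by rewrite ltNge; apply: contraTN bb => bb; rewrite -leNgt mulr_ge0 // subr_ge0.
have [bp|bp] := ltP 0 (b (prv k)).
  have [||e /andP[e1 e2] re] := ivt (l 0 (prv k)) z => //.
    by rewrite pmulr_llt0 // pz oppr_lt0 mulr_gt0 // Fpp_gap_left.
  by exists e; rewrite // e1 (lt_trans e2).
have bk : b k < 0 by apply: lt_le_trans bp.
have [||e /andP[e1 e2] re] := ivt z (l 0 k) => //.
  by rewrite pmulr_rlt0 // pz oppr_lt0 nmulr_rgt0 // Fpp_gap_right.
by exists e; rewrite // e2 (lt_trans z1).
Qed.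

End Kernel.

Section LinearizedSystem.
Variables (R : realType) (n : nat).
Implicit Types (u v w l : 'rV[R]_n) (i j k : 'I_n).

(** For [t > 0], [q'] has a zero in each of the [n-1] open gaps but degree at most
    [n-2], so it vanishes, and then so does [a] because [F_pp(l_k) <> 0].  For
    [t = 0] the gap equations say that [a] is constant, an infinitesimal
    translation of the roots.  It is excluded by the missing term in [p^n]:
    [q' + a F_pp] has degree less than [n] and [n] roots, so it is 0, and its
    coefficient of degree [n-1] is [n a]. *)
Lemma linearized_kernel u l (t : R) (q : {poly R}) (a : 'I_n -> R) :
  ordered_roots u l -> 0 <= t <= 1 -> (size q <= n)%N ->
  (forall k, q^`().[l 0 k] + (Fpp u).[l 0 k] * a k = 0) ->
  (forall k, (0 < k)%N ->
    t * (gapsign R k * (q.[l 0 k] - q.[l 0 (prv k)])) + (1 - t) * (a k - a (prv k)) = 0) ->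
  (forall k, k = 0%N :> nat -> q.[l 0 k] = 0) ->
  q = 0 /\ (forall k, a k = 0).
Proof.
move=> H /andP[t0 t1] sq Hq E q0.
case: n u l q a H sq Hq E q0 => [|n'] u l q a H sq Hq E q0.
  by split=> [|[]//]; apply/eqP; rewrite -size_poly_eq0 -leqn0.
have sdq : (size q^`() <= n')%N.
  by rewrite (leq_trans (size_deriv_le q)) //; move: sq; case: (size q).
suff dq0 : q^`() = 0.
  have a0 (k : 'I_n'.+1) : a k = 0.
    apply/eqP; have := Hq k; rewrite dq0 horner0 add0r => /eqP.
    by rewrite mulf_eq0 (negPf (Fpp_root_neq0 k H)).
  split=> //; have qC : q = (q`_0)%:P.
    apply: size1_polyC; rewrite leqNgt; apply/negP => sq1.
    have := lead_coef_eq0 q^`(); rewrite dq0 lead_coef0 eqxx => /esym.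
    have := coef_deriv q (size q).-2; rewrite dq0 coef0 prednK;
      last by case: (size q) sq1 => [|[]].
    move/esym/eqP; rewrite mulrn_eq0.
    rewrite -/(lead_coef q) lead_coef_eq0 -size_poly_eq0.
    by case: (size q) sq1 => [|[]].
  have := q0 ord0 erefl; rewrite qC hornerC => ->.
  by [].
have [t00|tn0] := eqVneq t 0.
  have al (k : 'I_n'.+1) : a k = a ord0.
    elim/prv_ind: k => [k k0|k k0 <-].
      by congr a; apply/val_inj.
    by have := E k k0; rewrite t00 mul0r add0r subr0 mul1r => /eqP; rewrite subr_eq0 => /eqP.
  pose p := q^`() + a ord0 *: Fpp u.
  have sFpp : (size (Fpp u) <= n'.+1)%N.
    by rewrite FppE (leq_trans (size_deriv_le _)) // size_Fp.
  have p0 : p = 0.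
    apply: (poly_eq0_increasing H.1) => [k|].
      by rewrite /p hornerD hornerZ mulrC -(al k) Hq.
    rewrite (leq_trans (size_polyD _ _)) // geq_max (leq_trans sdq) //=.
    by rewrite (leq_trans (size_scale_leq _ _)).
  have : p`_n' = 0 by rewrite p0 coef0.
  rewrite /p coefD coefZ nth_default // add0r FppE coef_deriv.
  have := monic_Fp u; rewrite lead_coefE size_Fp /= => -> /eqP.
  rewrite mulf_eq0 pnatr_eq0 orbF => /eqP a0.
  by move: p0; rewrite /p a0 scale0r addr0.
have tt : 0 < t <= 1 by rewrite lt_neqAle eq_sym tn0 t0.
(* Gap [i + 1], between the roots of index [i] and [i + 1]. *)
have ex (i : 'I_n') : exists x, l 0 (widen_ord (leqnSn n') i) < x < l 0
  (lift ord0 i) /\ root q^`() x.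
  have [||x xI rx] := @deriv_root_in_gap _ _ u l t q a (lift ord0 i) H tt _ Hq => //.
    exact: E.
  exists x; split=> //; move: xI; congr (_ && _); congr (l _ _ < _).
  exact/val_inj.
have [x Hx] := fin_all_exists ex.
apply: (poly_eq0_increasing (l := \row_i x i)) => // [i j ij|i]; last first.
  by rewrite mxE; apply/rootP; case: (Hx i).
rewrite !mxE; have [/andP[_ h1] _] := Hx i; have [/andP[h2 _] _] := Hx j.
apply: lt_trans h1 (le_lt_trans _ h2); apply: (increasing_le H.1).
by rewrite /= /bump /= add1n.
Qed.

End LinearizedSystem.

(** * A priori bounds *)

Section Bounds.
Variables (R : realType) (n : nat).
Implicit Types (u v w l : 'rV[R]_n) (i j k : 'I_n).

(** The left-hand side of the deformed equation for gap [k]; multiplication by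
    [gapsign] turns a difference of consecutive critical values into its
    absolute value. *)
Definition gapeq (t : R) u l k : R :=
  t * (gapsign R k * ((F u).[l 0 k] - (F u).[l 0 (prv k)]))
  + (1 - t) * (l 0 k - l 0 (prv k)).

Lemma F_increment u l k a b : ordered_roots u l -> (0 < k)%N ->
  l 0 (prv k) <= a -> a < b -> b <= l 0 k ->
  exists2 x, a < x < b &
    gapsign R k * ((F u).[b] - (F u).[a]) = (\prod_(j < n) `|x - l 0 j|) * (b - a).
Proof.
move=> H k0 la ab bl; have [x] := poly_mvt (F u) ab; rewrite in_itv /= => xI E.
exists x => //; rewrite E mulrA; congr (_ * _); apply: (Fp_gap H k0).
by case/andP: xI => x1 x2; rewrite (le_lt_trans la) // (lt_le_trans x2).
Qed.

Lemma F_increment_ge0 u l k a b : ordered_roots u l -> (0 < k)%N ->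
  l 0 (prv k) <= a -> a < b -> b <= l 0 k ->
  0 <= gapsign R k * ((F u).[b] - (F u).[a]).
Proof.
move=> H k0 la ab bl; have [x _ ->] := F_increment H k0 la ab bl.
by rewrite mulr_ge0 ?prodr_ge0 // subr_ge0 ltW.
Qed.

Lemma gap_lt u l k : ordered_roots u l -> (0 < k)%N -> l 0 (prv k) < l 0 k.
Proof. by move=> H k0; apply: H.1; exact: prv_lt. Qed.

(** At distance at least 1 from all the roots [|F'| >= 1], and the points of the
    gap at distance at least 1 from its ends form an interval of length the gap
    minus 2. *)
Lemma F_gap_ge u l k : ordered_roots u l -> (0 < k)%N ->
  l 0 k - l 0 (prv k) - 2 <= gapsign R k * ((F u).[l 0 k] - (F u).[l 0 (prv k)]).
Proof.
move=> H k0; have g0 := gap_lt H k0.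
set p := l 0 (prv k) in g0 *; set q := l 0 k in g0 *.
have [g2|g2] := leP (q - p) 2.
  by rewrite (le_trans (_ : _ <= 0)) ?subr_le0 //; apply: (F_increment_ge0 H k0).
have ab : p + 1 < q - 1 by lra.
have [||x /andP[x1 x2] E] := F_increment H k0 _ ab; rewrite -?/p -?/q; [lra|lra|].
have e1 : 0 <= gapsign R k * ((F u).[p + 1] - (F u).[p]).
  by apply: (F_increment_ge0 H k0); rewrite -?/p -?/q; lra.
have e2 : 0 <= gapsign R k * ((F u).[q] - (F u).[q - 1]).
  by apply: (F_increment_ge0 H k0); rewrite -?/p -?/q; lra.
(* Each factor is at least 1, as [x] lies in the trimmed gap. *)
have P1 : 1 <= \prod_(j < n) `|x - l 0 j|.
  apply: (big_ind (fun y => 1 <= y)) => // [y z|j _]; first exact: mulr_ege1.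
  have [jk|jk] := ltnP j k.
    have : l 0 j <= p by apply: (increasing_le H.1); rewrite /= -ltnS prednK.
    by rewrite ler_normr; lra.
  have : q <= l 0 j by exact: (increasing_le H.1).
  by rewrite ler_normr; lra.
have e3 : q - p - 2 <= (\prod_(j < n) `|x - l 0 j|) * (q - 1 - (p + 1)).
  by apply: le_trans (_ : 1 * (q - 1 - (p + 1)) <= _); [lra|rewrite ler_wpM2r //; lra].
by rewrite -E in e3; lra.
Qed.

Lemma gap_ub (t : R) u l k : ordered_roots u l -> 0 <= t <= 1 -> (0 < k)%N ->
  l 0 k - l 0 (prv k) <= gapeq t u l k + 2.
Proof.
move=> H /andP[t0 t1] k0; have := F_gap_ge H k0; have := gap_lt H k0; rewrite /gapeq.
set D := gapsign R k * _; set g := l 0 k - l 0 (prv k) => g0 h.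
have : t * (g - 2) <= t * D by rewrite ler_wpM2l.
nra.
Qed.

Definition root_bound (c : 'rV[R]_n) : R := \sum_k (`|c 0 k| + 2).

Lemma root_spread (t : R) u l (c : 'rV[R]_n) : ordered_roots u l -> 0 <= t <= 1 ->
  (forall k, (0 < k)%N -> gapeq t u l k = c 0 k) ->
  forall i j, l 0 i - l 0 j <= root_bound c.
Proof.
move=> H t01 E i j.
have pos (m : 'I_n) : 0 <= `|c 0 m| + 2 by rewrite addr_ge0.
have key k : l 0 k - l 0 j <= \sum_(m < n | (m <= k)%N) (`|c 0 m| + 2).
  elim/prv_ind: k => [k k0|k k0 IH].
    rewrite (le_trans (_ : _ <= 0)) ?sumr_ge0 // subr_le0.
    by apply: (increasing_le H.1); rewrite k0.
  rewrite (bigD1 k) //=.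
  have -> : l 0 k - l 0 j = (l 0 k - l 0 (prv k)) + (l 0 (prv k) - l 0 j) by ring.
  apply: lerD.
    by rewrite (le_trans (gap_ub H t01 k0)) // lerD2r E // ler_norm.
  apply: le_trans IH _; rewrite [leRHS](eq_bigl (fun m : 'I_n => (m <= prv k)%N)) //.
  by move=> m; rewrite -(inj_eq val_inj) /=; move: k0; lia.
rewrite (le_trans (key i)) // /root_bound [leRHS](bigID (fun m : 'I_n => (m <= i)%N)) /=.
by rewrite lerDl sumr_ge0.
Qed.

(** The roots have mean 0, so each is bounded by the distance between the extreme
    ones. *)
Lemma root_le_bound (t : R) u l (c : 'rV[R]_n) : ordered_roots u l -> 0 <= t <= 1 ->
  (forall k, (0 < k)%N -> gapeq t u l k = c 0 k) ->
  forall k, `|l 0 k| <= root_bound c.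
Proof.
move=> H t01 E k; have n0 : (0 < n)%N by case: n k => [[]|].
have sp := root_spread H t01 E; have s0 := sum_roots n0 H.
have nn : 0 < n%:R :> R by rewrite ltr0n.
rewrite ler_norml; apply/andP; split.
  rewrite -(ler_pM2l nn) -subr_ge0.
  have -> : n%:R * l 0 k - n%:R * - root_bound c = \sum_(j < n) (l 0 k + root_bound c - l 0 j).
    by rewrite sumrB s0 sumr_const card_ord -[_ *+ n]mulr_natl; ring.
  by apply: sumr_ge0 => j _; have := sp j k; lra.
rewrite -(ler_pM2l nn) -subr_ge0.
have -> : n%:R * root_bound c - n%:R * l 0 k = \sum_(j < n) (root_bound c - l 0 k + l 0 j).
  by rewrite big_split /= s0 sumr_const card_ord -[_ *+ n]mulr_natl; ring.
by apply: sumr_ge0 => j _; have := sp k j; lra.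
Qed.

Lemma root_bound_ge0 c : 0 <= root_bound c.
Proof. by apply: sumr_ge0 => k _; rewrite addr_ge0. Qed.

(** On a gap [|F'|] is at most the [n]-th power of the distance between the
    extreme roots, so a prescribed positive value [c_k] keeps the gap from
    closing. *)
Lemma gap_lb (t : R) u l (c : 'rV[R]_n) : ordered_roots u l -> 0 <= t <= 1 ->
  (forall k, (0 < k)%N -> gapeq t u l k = c 0 k) ->
  forall k, (0 < k)%N -> c 0 k <= (1 + root_bound c ^+ n) * (l 0 k - l 0 (prv k)).
Proof.
move=> H t01 E k k0; have := E k k0; case/andP: (t01) => t0 t1; rewrite /gapeq.
have g0 := gap_lt H k0.
have [x /andP[x1 x2] ->] := F_increment H k0 (lexx _) g0 (lexx _).
have PB : \prod_(j < n) `|x - l 0 j| <= root_bound c ^+ n.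
  rewrite -[n in leRHS]card_ord -prodr_const.
  apply: ler_prod => j _; rewrite normr_ge0 ler_norml /=.
  have := root_spread H t01 E k j; have := root_spread H t01 E j (prv k); lra.
set g := l 0 k - l 0 (prv k); have g0' : 0 < g by rewrite subr_gt0.
set P := \prod_(j < n) _ in PB *; set B := root_bound c ^+ n in PB *.
have P0 : 0 <= P by apply: prodr_ge0.
have h1 : P * g <= B * g by rewrite ler_wpM2r // ltW.
have h2 : t * (P * g) <= P * g by rewrite ler_piMl // mulr_ge0 // ltW.
have h3 : (1 - t) * g <= g by rewrite ler_piMl ?(ltW g0') //; lra.
move=> <-; lra.
Qed.

Lemma coef_prod_XsubC_le (s : seq R) (B : R) : 0 <= B -> all (fun x => `|x| <= B) s ->
  forall m, `|(\prod_(x <- s) ('X - x%:P))`_m| <= (1 + B) ^+ size s.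
Proof.
move=> B0; elim: s => [_|x s IH /= /andP[xB sB]] m.
  by rewrite big_nil coef1 expr0; case: eqP; rewrite ?normr1 ?normr0.
rewrite big_cons mulrBl coefB coefXM coefCM exprS mulrDl mul1r.
rewrite (le_trans (ler_normB _ _)) // lerD //.
  by case: eqP => _; rewrite ?normr0 ?IH // exprn_ge0 // addr_ge0.
by rewrite normrM ler_pM // IH.
Qed.

(** The product formula for [F'] bounds its coefficients, hence all coefficients of
    [F] except the constant one, which is recovered from the value of [F] at the
    first root. *)
Lemma coef_le_bound u l (B r : R) : 0 <= B -> ordered_roots u l -> (forall k, `|l 0 k| <= B) ->
  (forall k, k = 0%N :> nat -> `|(F u).[l 0 k]| <= r) ->
  forall k, `|u 0 k| <= r + n.+2%:R * (1 + B) ^+ (n.+1 + n).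
Proof.
move=> B0 H lB Fr k; have n0 : (0 < n)%N by case: n k => [[]|].
pose o := Ordinal n0; have r0 : 0 <= r by apply: le_trans (Fr o erefl).
have B1 : 1 <= 1 + B by rewrite lerDl.
have Bp m : 0 <= (1 + B) ^+ m by rewrite exprn_ge0 // addr_ge0.
have cF m : `|(F u)`_m.+1| <= (1 + B) ^+ n.
  have := @coef_prod_XsubC_le (row_seq l) B B0; rewrite size_row_seq big_row_seq -(Fp_prod H).
  move=> /(_ _ m) h; apply: le_trans (h _); last by apply/allP => _ /mapP[j _ ->].
  by rewrite /Fp coef_deriv normrMn mulrS lerDl mulrn_wge0.
have powB m : (m <= n)%N -> (1 + B) ^+ (n + m.+1) <= (1 + B) ^+ (n.+1 + n).
  by move=> mn; rewrite ler_weXn2l // addSn addnS ltnS leq_add2l.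
have uF : u 0 k = (F u)`_(n.-1 - k).
  rewrite FE coefD coefZ coefXn coef_lower_rev (_ : (_ == _) = false) ?mulr0 ?add0r //.
  by apply/eqP; have := ltn_ord k; lia.
rewrite uF; case: (n.-1 - k)%N => [|m]; last first.
  apply: le_trans (cF m) _; rewrite -[leLHS]add0r lerD // -[leLHS]mul1r ler_pM //.
    by rewrite ler1n.
  by rewrite ler_weXn2l // leq_addl.
have := Fr o erefl; rewrite horner_coef size_F big_ord_recl expr0 mulr1.
set S := (X in _ + X) => FS.
have SB : `|S| <= n.+1%:R * (1 + B) ^+ (n.+1 + n).
  apply: le_trans (ler_norm_sum _ _ _) _.
  apply: le_trans (_ : \sum_(m < n.+1) (1 + B) ^+ (n.+1 + n) <= _); last first.
    by rewrite sumr_const card_ord mulr_natl.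
  apply: ler_sum => m _.
  rewrite normrM lift0; apply: le_trans _ (powB m _); last by rewrite -ltnS.
  rewrite exprD ler_pM // normrX; apply: le_trans (_ : B ^+ m.+1 <= _).
    by rewrite lerXn2r // ?nnegrE.
  by rewrite lerXn2r // ?nnegrE ?lerDr ?addr_ge0.
rewrite [n.+2%:R]mulrS mulrDl mul1r.
have -> : (F u)`_0 = ((F u)`_0 + S) - S by ring.
by rewrite (le_trans (ler_normB _ _)) // lerD // (le_trans SB) // lerDr.
Qed.

End Bounds.

(** * Newton's method for systems with a continuous secant *)

Section MatrixNorm.
Variable R : realType.

Lemma norm_entry m n (A : 'M[R]_(m, n)) i j : `|A i j| <= `|A|.
Proof.
rewrite [leRHS]/Num.norm /= mx_normrE.
exact: (le_bigmax _ (fun ij : 'I_m * 'I_n => `|A ij.1 ij.2|) (i, j)).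
Qed.

Lemma norm_mx_le m n (A : 'M[R]_(m, n)) c : 0 <= c ->
  (forall i j, `|A i j| <= c) -> `|A| <= c.
Proof.
move=> c0 Ac; rewrite [leLHS]/Num.norm /= mx_normrE.
by apply/bigmax_leP; split=> // -[i j] _; apply: Ac.
Qed.

Lemma norm_mulmx m n p (A : 'M[R]_(m, n)) (B : 'M[R]_(n, p)) :
  `|A *m B| <= n%:R * `|A| * `|B|.
Proof.
apply: norm_mx_le => [|i j]; first by rewrite !mulr_ge0.
rewrite mxE (le_trans (ler_norm_sum _ _ _)) //.
apply: le_trans (_ : \sum_(k < n) `|A| * `|B| <= _).
  by apply: ler_sum => k _; rewrite normrM ler_pM // norm_entry.
by rewrite sumr_const card_ord -mulrA mulr_natl.
Qed.

End MatrixNorm.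

(** Records the completeness of spaces of matrices among normed modules, where the
    fixed point theorem for contractions is stated. *)
HB.instance Definition _ (R : realType) (m n : nat) :=
  Uniform_isComplete.Build 'M[R]_(m, n) cauchy_cvg.

Section Newton.
Variables (R : realType) (N : nat).

(** Newton's iteration with the derivative frozen at [A0]: since the secant
    matrices are close to [A0], the map [x - f p x A0^-1] contracts a small ball
    around [x0] by the factor 1/2, and it maps the ball to itself as soon as
    [f p x0] is small.  Its fixed point is the zero sought. *)
Lemma solvable_near (P : Type) (Flt : set_system P) (FF : Filter Flt)
    (f : P -> 'rV[R]_N -> 'rV[R]_N) (A : P -> 'rV[R]_N -> 'rV[R]_N -> 'M[R]_N)
    (x0 : 'rV[R]_N) (A0 : 'M[R]_N) :
  (forall p x y, f p x - f p y = (x - y) *m A p x y) ->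
  A0 \in unitmx ->
  A z.1 z.2.1 z.2.2 @[z --> (Flt, (nbhs x0, nbhs x0))] --> A0 ->
  f p x0 @[p --> Flt] --> (0 : 'rV[R]_N) ->
  forall e : R, 0 < e -> \forall p \near Flt, exists2 x, `|x - x0| <= e & f p x = 0.
Proof.
move=> fA uA0 cA cf e e0; pose M := invmx A0.
(* Secant matrices within [d] of [A0] make the iteration contract by 1/2; the
   two factors [N] come from [norm_mulmx]. *)
pose d := (2 * (N%:R * (N%:R * `|M|)) + 1)^-1.
have d0 : 0 < d by rewrite invr_gt0 ltr_wpDl // !mulr_ge0.
have [[Q W] /= [FQ [[B1 B2] /= [nB1 nB2] BW]] AQ] := (cvgrPdist_lt _ _).1 cA d d0.
have [r1 /= r10 B1r] := (nbhs_ballP _ _).1 nB1.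
have [r2 /= r20 B2r] := (nbhs_ballP _ _).1 nB2.
pose r := Num.min e (Num.min (r1 / 2) (r2 / 2)).
have r0 : 0 < r by rewrite !lt_min e0 !divr_gt0.
have rr1 : r < r1.
  by rewrite !gt_min; apply/orP; right; apply/orP; left; rewrite ltr_pdivrMr // ltr_pMr ?ltr1n.
have rr2 : r < r2.
  by rewrite !gt_min; apply/orP; right; apply/orP; right; rewrite ltr_pdivrMr // ltr_pMr ?ltr1n.
pose U : set 'rV[R]_N := closed_ball_ Num.Def.normr x0 r.
have UB x : U x -> B1 x /\ B2 x.
  rewrite /U /closed_ball_ /= => xr.
  by split; [apply: B1r|apply: B2r]; rewrite -ball_normE /ball_ /=; apply: le_lt_trans xr _.
have half p x y : Q p -> U x -> U y ->
    `|(x - f p x *m M) - (y - f p y *m M)| <= 2^-1 * `|x - y|.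
  move=> Qp Ux Uy.
  have -> : (x - f p x *m M) - (y - f p y *m M) = (x - y) *m ((A0 - A p x y) *m M).
    rewrite [(A0 - _) *m M]mulmxBl (mulmxV uA0 : A0 *m M = 1%:M).
    rewrite mulmxBr mulmx1 mulmxA -fA mulmxBl !opprB addrACA [RHS]addrACA.
    by congr (_ + _); rewrite addrC.
  have Ad : `|A0 - A p x y| < d.
    apply: (AQ (p, (x, y))); split => //=; apply: BW.
    by split; [case: (UB x Ux)|case: (UB y Uy)].
  apply: le_trans (norm_mulmx _ _) _; rewrite mulrAC ler_wpM2r //.
  apply: le_trans (_ : N%:R * (N%:R * d * `|M|) <= _).
    rewrite ler_wpM2l // (le_trans (norm_mulmx _ _)) // ler_wpM2r // ler_wpM2l // ltW //.
  rewrite (_ : _ * (_ * _ * _) = d * (N%:R * (N%:R * `|M|))); last by ring.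
  rewrite /d mulrC ler_pdivrMr ?ltr_wpDl ?mulr_ge0 //.
  set X := N%:R * (N%:R * `|M|); lra.
(* Below [d'], the first Newton step has length at most [r / 2]. *)
pose d' := r / (2 * (N%:R * `|M| + 1)).
have d'0 : 0 < d' by rewrite divr_gt0 // mulr_gt0 // ltr_wpDl // mulr_ge0.
have nf : \forall p \near Flt, `|0 - f p x0| < d' by exact: (cvgrPdist_lt _ _).1 cf d' d'0.
apply: filterS2 FQ nf => p Qp; rewrite sub0r normrN => fd'.
pose g x := x - f p x *m M.
have Ux0 : U x0 by rewrite /U /closed_ball_ /= subrr normr0 ltW.
have gU : {homo g : x / U x >-> U x}.
  move=> x Ux; rewrite /U /closed_ball_ /= distrC.
  have -> : g x - x0 = (g x - g x0) + (g x0 - x0) by rewrite addrA subrK.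
  rewrite (le_trans (ler_normD _ _)) // (splitr r) lerD //.
    rewrite (le_trans (half p x x0 Qp Ux Ux0)) // mulrC ler_pM2r ?invr_gt0 //.
    by rewrite distrC.
  rewrite /g addrC addKr normrN (le_trans (norm_mulmx _ _)) //.
  rewrite mulrAC (le_trans (_ : _ <= (N%:R * `|M|) * d')) //.
    by rewrite ler_wpM2l ?mulr_ge0 // ltW.
  have K0 : 0 <= N%:R * `|M| by rewrite mulr_ge0.
  rewrite /d'; set K := N%:R * `|M| in K0 *.
  have K1 : K + 1 != 0 by rewrite gt_eqF // ltr_wpDl.
  rewrite (_ : K * (r / (2 * (K + 1))) = (r / 2) * (K / (K + 1))); last by field.
  rewrite ler_piMr ?divr_ge0 ?(ltW r0) //.
  by rewrite ler_pdivrMr ?mul1r ?lerDl // ltr_wpDl.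
pose gf : {fun U >-> U} := mkfun gU.
have [|||x Ux xg] := @banach_fixed_point R _ U gf.
- exists (2^-1)%:nng; split => /=; first by rewrite invf_lt1 // ltr1n.
  by move=> [x y] [/= Ux Uy]; apply: half.
- exact: closed_closed_ball_.
- by exists x0.
exists x.
  move: Ux; rewrite /U /closed_ball_ /= distrC => /le_trans; apply.
  by rewrite ge_min lexx.
move: xg => /= /eqP; rewrite /g eq_sym -subr_eq0 addrAC subrr add0r oppr_eq0 => /eqP fM.
by rewrite -[f p x](mulmxKV uA0) -/M fM mul0mx.
Qed.

End Newton.

(** * Continuity of polynomial expressions *)

Section Continuity.
Variables (R : realType) (Z : topologicalType).
Implicit Types f g : Z -> R.

Lemma contD f g : continuous f -> continuous g -> continuous (fun z => f z + g z).
Proof. by move=> cf cg z; apply: cvgD; [exact: cf|exact: cg]. Qed.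

Lemma contB f g : continuous f -> continuous g -> continuous (fun z => f z - g z).
Proof. by move=> cf cg z; apply: cvgB; [exact: cf|exact: cg]. Qed.

Lemma contM f g : continuous f -> continuous g -> continuous (fun z => f z * g z).
Proof. by move=> cf cg z; apply: cvgM; [exact: cf|exact: cg]. Qed.

Lemma contC (c : R) : continuous (fun _ : Z => c).
Proof. by move=> z; apply: cvg_cst. Qed.

Lemma contX f m : continuous f -> continuous (fun z => f z ^+ m).
Proof.
move=> cf; elim: m => [|m IH]; first by under eq_fun do rewrite expr0; exact: contC.
by under eq_fun do rewrite exprS; exact: contM.
Qed.

Lemma cont_fst (A B : topologicalType) (w : Z -> A * B) :
  continuous w -> continuous (fun z => (w z).1).
Proof. by move=> cw z; apply: (@cvg_comp _ _ _ w fst); [exact: cw|exact: cvg_fst]. Qed.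

Lemma cont_snd (A B : topologicalType) (w : Z -> A * B) :
  continuous w -> continuous (fun z => (w z).2).
Proof. by move=> cw z; apply: (@cvg_comp _ _ _ w snd); [exact: cw|exact: cvg_snd]. Qed.

Lemma cont_sum m (f : 'I_m -> Z -> R) : (forall i, continuous (f i)) ->
  continuous (fun z => \sum_(i < m) f i z).
Proof.
by move=> cf z; apply: cvg_big => [|i _]; [exact: add_continuous|exact: cf].
Qed.

Lemma cont_coord m (x : Z -> 'rV[R]_m) i : continuous x -> continuous (fun z => x z 0 i).
Proof.
by move=> cx z; apply: (@cvg_comp _ _ _ x (fun M : 'rV[R]_m => M 0 i));
  [exact: cx|exact: coord_continuous].
Qed.

Lemma cont_horner N (p : Z -> {poly R}) (a : Z -> R) :
  (forall z, size (p z) <= N)%N -> (forall m, continuous (fun z => (p z)`_m)) ->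
  continuous a -> continuous (fun z => (p z).[a z]).
Proof.
move=> sp cp ca; under eq_fun => z do rewrite (horner_coef_wide _ (sp z)).
by apply: cont_sum => i; apply: contM => //; exact: contX.
Qed.

Lemma cont_secant N (p : Z -> {poly R}) (a b : Z -> R) :
  (forall m, continuous (fun z => (p z)`_m)) ->
  continuous a -> continuous b -> continuous (fun z => secant N (p z) (a z) (b z)).
Proof.
move=> cp ca cb; apply: cont_sum => i; apply: contM => //; apply: cont_sum => j.
by apply: contM; exact: contX.
Qed.

Lemma cont_coef_deriv (p : Z -> {poly R}) :
  (forall m, continuous (fun z => (p z)`_m)) ->
  forall m, continuous (fun z => (p z)^`()`_m).
Proof.
move=> cp m; under eq_fun => z do rewrite coef_deriv -mulr_natr.
by apply: contM => //; exact: contC.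
Qed.

Lemma cont_coef_lower n (u : Z -> 'rV[R]_n) : (forall k, continuous (fun z => u z 0 k)) ->
  forall m, continuous (fun z => (lower (u z))`_m).
Proof.
move=> cu m; under eq_fun => z do rewrite coef_lower.
by apply: cont_sum => i; apply: contM; [exact: cu|exact: contC].
Qed.

Lemma cont_coef_F n (u : Z -> 'rV[R]_n) : (forall k, continuous (fun z => u z 0 k)) ->
  forall m, continuous (fun z => (F (u z))`_m).
Proof.
move=> cu m; under eq_fun => z do rewrite FE coefD.
by apply: contD; [exact: contC|exact: cont_coef_lower].
Qed.

End Continuity.

(** * The system relating coefficients, critical points and critical values *)

Section System.
Variables (R : realType) (n : nat).
Implicit Types (u v w l : 'rV[R]_n) (x y e : 'rV[R]_(n + n)) (i j k : 'I_n) (t : R).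

Lemma entry_row m (f : 'I_m -> R) (k : 'I_m) : (\row_i f i) 0 k = f k.
Proof. by rewrite mxE. Qed.

Lemma entry0 m (k : 'I_m) : (0 : 'rV[R]_m) 0 k = 0.
Proof. by rewrite mxE. Qed.

Lemma entryB m (a b : 'rV[R]_m) (k : 'I_m) : (a - b) 0 k = a 0 k - b 0 k.
Proof. by rewrite !mxE. Qed.

Lemma entryZ m (c : R) (a : 'rV[R]_m) (k : 'I_m) : (c *: a) 0 k = c * a 0 k.
Proof. by rewrite !mxE. Qed.

Lemma entry_lin m (c : R) (a b : 'rV[R]_m) (k : 'I_m) : (c *: a + b) 0 k = c * a 0 k + b 0 k.
Proof. by rewrite !mxE. Qed.

(** A point of the space is a pair [(u, l)], and no relation is imposed between the
    two halves: the first block of equations states that the [l_k] are critical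
    points.  In this form the equations are polynomial in all unknowns. *)
Definition system t x : 'rV[R]_(n + n) :=
  row_mx (\row_k (Fp (lsubmx x)).[rsubmx x 0 k])
         (\row_k if k == 0%N :> nat then (F (lsubmx x)).[rsubmx x 0 k]
                 else gapeq t (lsubmx x) (rsubmx x) k).

(** The secants of [F_u(l_k)] and [F_u'(l_k)] between the points [x] and [y],
    applied to the vector [e]; [system_secant] assembles them into the secant of
    [system]. *)
Definition value_secant x y e k : R :=
  (lower (lsubmx e)).[rsubmx x 0 k]
  + rsubmx e 0 k * secant n.+2 (F (lsubmx y)) (rsubmx x 0 k) (rsubmx y 0 k).

Definition slope_secant x y e k : R :=
  (lower (lsubmx e))^`().[rsubmx x 0 k]
  + rsubmx e 0 k * secant n.+2 (Fp (lsubmx y)) (rsubmx x 0 k) (rsubmx y 0 k).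

Definition system_secant t x y e : 'rV[R]_(n + n) :=
  row_mx (\row_k slope_secant x y e k)
         (\row_k if k == 0%N :> nat then value_secant x y e k
                 else t * (gapsign R k * (value_secant x y e k - value_secant x y e (prv k)))
                      + (1 - t) * (rsubmx e 0 k - rsubmx e 0 (prv k))).

Lemma value_secantP x y k :
  (F (lsubmx x)).[rsubmx x 0 k] - (F (lsubmx y)).[rsubmx y 0 k] = value_secant x y (x - y) k.
Proof.
rewrite /value_secant [lsubmx (_ - _)]linearB [rsubmx (_ - _)]linearB /= -FB.
by rewrite hornerD hornerN entryB -secantP ?size_F // addrA subrK.
Qed.

Lemma slope_secantP x y k :
  (Fp (lsubmx x)).[rsubmx x 0 k] - (Fp (lsubmx y)).[rsubmx y 0 k] = slope_secant x y (x - y) k.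
Proof.
rewrite /slope_secant [lsubmx (_ - _)]linearB [rsubmx (_ - _)]linearB /= -FB linearB /=.
by rewrite -!/(Fp _) hornerD hornerN entryB -secantP ?size_Fp // addrA subrK.
Qed.

Lemma system_secantP t x y : system t x - system t y = system_secant t x y (x - y).
Proof.
rewrite /system opp_row_mx add_row_mx; congr row_mx; apply/rowP => k; rewrite entryB !entry_row.
  exact: slope_secantP.
case: ifP => k0; first by rewrite -value_secantP.
by rewrite -!value_secantP /gapeq [rsubmx (_ - _)]linearB /= !entryB; ring.
Qed.

Lemma system_secant_linear t x y : linear (system_secant t x y).
Proof.
have vl a e e' k : value_secant x y
  (a *: e + e') k = a * value_secant x y e k + value_secant x y e' k.
  rewrite /value_secant [lsubmx (_ + _)]linearP [rsubmx (_ + _)]linearP /=.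
  by rewrite lowerD lowerZ hornerD hornerZ entry_lin; ring.
have sl a e e' k : slope_secant x y
  (a *: e + e') k = a * slope_secant x y e k + slope_secant x y e' k.
  rewrite /slope_secant [lsubmx (_ + _)]linearP [rsubmx (_ + _)]linearP /=.
  by rewrite lowerD lowerZ linearP /= hornerD hornerZ entry_lin; ring.
move=> a e e'; rewrite /system_secant scale_row_mx add_row_mx.
congr row_mx; apply/rowP => k; rewrite entry_lin !entry_row ?sl //.
case: ifP => k0; first by rewrite vl.
by rewrite !vl [rsubmx (_ + _)]linearP /= !entry_lin; ring.
Qed.

HB.instance Definition _ t x y :=
  GRing.isLinear.Build R 'rV[R]_(n + n) 'rV[R]_(n + n) _ (system_secant t x y)
    (system_secant_linear t x y).

Definition system_matrix t x y : 'M[R]_(n + n) := lin1_mx (system_secant t x y).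

Lemma mul_system_matrix t x y e : e *m system_matrix t x y = system_secant t x y e.
Proof. exact: mul_rV_lin1. Qed.

Lemma system_matrixP t x y : system t x - system t y = (x - y) *m system_matrix t x y.
Proof. by rewrite mul_system_matrix system_secantP. Qed.

Definition solution (c : 'rV[R]_(n + n)) t x :=
  increasing (rsubmx x) /\ system t x = c.

Lemma solution_roots c t x : solution (row_mx 0 c) t x -> ordered_roots (lsubmx x) (rsubmx x).
Proof.
case=> il /eq_row_mx[/rowP E _]; split=> // k.
by apply/rootP; have := E k; rewrite entry_row entry0.
Qed.

Lemma solution_value c t x : solution (row_mx 0 c) t x ->
  forall k, k = 0%N :> nat -> (F (lsubmx x)).[rsubmx x 0 k] = c 0 k.
Proof.
by case=> _ /eq_row_mx[_ /rowP E] k k0; have := E k; rewrite entry_row k0 eqxx.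
Qed.

Lemma solution_gap c t x : solution (row_mx 0 c) t x ->
  forall k, (0 < k)%N -> gapeq t (lsubmx x) (rsubmx x) k = c 0 k.
Proof.
by case=> _ /eq_row_mx[_ /rowP E] k k0; have := E k; rewrite entry_row eqn0Ngt k0.
Qed.

(** At a solution the secant on the diagonal is the linearized system, with
    [q = lower (lsubmx e)] and [a = rsubmx e]. *)
Lemma system_secant_kernel c t x e : solution (row_mx 0 c) t x -> 0 <= t <= 1 ->
  system_secant t x x e = 0 -> e = 0.
Proof.
move=> S t01; have H := solution_roots S.
rewrite -[0 in X in X -> _]row_mx0 => /eq_row_mx[/rowP E1 /rowP E2].
have vE k : value_secant x x e k = (lower (lsubmx e)).[rsubmx x 0 k].
  rewrite /value_secant secant_diag ?size_F // -/(Fp _).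
  by have /rootP -> := H.2 k; rewrite mulr0 addr0.
have [|k|k k0|k k0|q0 a0] :=
  linearized_kernel (q := lower (lsubmx e)) (a := rsubmx e 0) H t01.
- exact: size_lower.
- have := E1 k; rewrite entry_row entry0 /slope_secant secant_diag; last by rewrite size_Fp.
  by rewrite -FppE [_ * rsubmx e 0 k]mulrC.
- by have := E2 k; rewrite entry_row entry0 eqn0Ngt k0 /= !vE.
- by have := E2 k; rewrite entry_row entry0 k0 eqxx vE.
rewrite -[e]hsubmxK (lower_inj q0) (_ : rsubmx e = 0) ?row_mx0 //.
by apply/rowP => k; rewrite a0 mxE.
Qed.

Lemma system_matrix_unit c t x : solution (row_mx 0 c) t x -> 0 <= t <= 1 ->
  system_matrix t x x \in unitmx.
Proof.
move=> S t01; rewrite -row_free_unit; apply/inj_row_free => e.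
by rewrite mul_system_matrix; exact: system_secant_kernel S t01.
Qed.

Lemma cont_system_secant (Z : topologicalType) (t : Z -> R) (x y e : Z ->
  'rV[R]_(n + n)) (i : 'I_(n + n)) :
  continuous t -> continuous x -> continuous y -> continuous e ->
  continuous (fun z => system_secant (t z) (x z) (y z) (e z) 0 i).
Proof.
move=> ct cx cy ce.
have cl (w : Z -> 'rV[R]_(n + n)) : continuous w ->
  forall k, continuous (fun z => lsubmx (w z) 0 k).
  by move=> cw k; under eq_fun => z do rewrite mxE; exact: cont_coord.
have cr (w : Z -> 'rV[R]_(n + n)) : continuous w ->
  forall k, continuous (fun z => rsubmx (w z) 0 k).
  by move=> cw k; under eq_fun => z do rewrite mxE; exact: cont_coord.
have cv k : continuous (fun z => value_secant (x z) (y z) (e z) k).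
  apply: contD; first by apply: (cont_horner (N := n)) (cr _ cx _) => [z|];
    [exact: size_lower|exact: cont_coef_lower (cl _ ce)].
  apply: contM; first exact: cr.
  by apply: cont_secant; [exact: cont_coef_F (cl _ cy)|exact: cr|exact: cr].
have cs k : continuous (fun z => slope_secant (x z) (y z) (e z) k).
  apply: contD.
    apply: (cont_horner (N := n.-1)) (cr _ cx _) => [z|]; first exact: size_deriv_lower.
    exact: cont_coef_deriv (cont_coef_lower (cl _ ce)).
  apply: contM; first exact: cr.
  by apply: cont_secant; [exact: cont_coef_deriv (cont_coef_F (cl _ cy))|exact: cr|exact: cr].
case: (split_ordP i) => k ->.
  by under eq_fun => z do rewrite row_mxEl mxE; exact: cs.
under eq_fun => z do rewrite row_mxEr mxE.
case: (k == 0%N :> nat); first exact: cv.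
apply: contD; first by apply: contM => //; apply: contM; [exact: contC|exact: contB].
by apply: contM; apply: contB => //; [exact: contC|exact: cr|exact: cr].
Qed.

Lemma cont_system (Z : topologicalType) (t : Z -> R) (x : Z ->
  'rV[R]_(n + n)) (i : 'I_(n + n)) :
  continuous t -> continuous x -> continuous (fun z => system (t z) (x z) 0 i).
Proof.
move=> ct cx.
have cl k : continuous (fun z => lsubmx (x z) 0 k).
  by under eq_fun => z do rewrite mxE; exact: cont_coord.
have cr k : continuous (fun z => rsubmx (x z) 0 k).
  by under eq_fun => z do rewrite mxE; exact: cont_coord.
have cF k : continuous (fun z => (F (lsubmx (x z))).[rsubmx (x z) 0 k]).
  by apply: (cont_horner (N := n.+2)) (cr _) => [z|]; [rewrite size_F|exact: cont_coef_F].
case: (split_ordP i) => k ->.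
  under eq_fun => z do rewrite row_mxEl mxE.
  apply: (cont_horner (N := n.+1)) (cr _) => [z|]; first by rewrite size_Fp.
  exact: cont_coef_deriv (cont_coef_F _).
under eq_fun => z do rewrite row_mxEr mxE.
case: (k == 0%N :> nat); first exact: cF.
apply: contD; first by apply: contM => //; apply: contM; [exact: contC|exact: contB].
by apply: contM; apply: contB => //; exact: contC.
Qed.

End System.

(** * Compactness and uniqueness *)

Section Closed.
Variables (R : realType) (T : topologicalType).

Lemma closed_forall (I : Type) (P : I -> set T) :
  (forall i, closed (P i)) -> closed [set z | forall i, P i z].
Proof.
move=> cP; rewrite (_ : mkset _ = \bigcap_(i in [set: I]) P i); first exact: closed_bigI.
by apply/seteqP; split=> z /= Pz i; [move=> _; exact: Pz|exact: (Pz i)].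
Qed.

Lemma closed_level (g : T -> R) : continuous g -> closed [set z | g z = 0].
Proof. by move=> cg; exact: (continuous_closedP _).1 cg _ (@closed_eq _ 0). Qed.

Lemma closed_nonneg (g : T -> R) : continuous g -> closed [set z | 0 <= g z].
Proof. by move=> cg; exact: (continuous_closedP _).1 cg _ (@closed_ge _ 0). Qed.

End Closed.

Lemma compact_norm_ball (R : realType) m (M : R) : compact [set x : 'rV[R]_m | `|x| <= M].
Proof.
apply: bounded_closed_compact.
  exists M; split; first exact: num_real.
  by move=> N MN x /= xM; apply: le_trans xM (ltW MN).
rewrite (_ : mkset _ = [set x | 0 <= M - `|x|]); last first.
  by apply/seteqP; split=> x /=; rewrite subr_ge0.
apply: closed_nonneg; apply: contB; first exact: contC.
exact: norm_continuous.
Qed.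

Section Uniqueness.
Variables (R : realType) (n : nat).
Implicit Types (u v w l c : 'rV[R]_n) (x y e : 'rV[R]_(n + n)) (i j k : 'I_n) (t : R).

Lemma increasing_gaps l : (forall k, (0 < k)%N -> l 0 (prv k) < l 0 k) -> increasing l.
Proof.
move=> h i j; elim/prv_ind: j => [j ->|j j0 IH ij]; first by rewrite ltn0.
have [e|ne] := eqVneq i (prv j); first by rewrite e h.
apply: lt_trans (h j j0); apply: IH.
by move: ij ne; rewrite -(inj_eq val_inj) /=; lia.
Qed.

(** [F] is strictly monotone on each gap. *)
Lemma solution_target_gt0 c t x : solution (row_mx 0 c) t x -> 0 <= t <= 1 ->
  forall k, (0 < k)%N -> 0 < c 0 k.
Proof.
move=> S /andP[t0 t1] k k0; have H := solution_roots S.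
rewrite -(solution_gap S k0) /gapeq; have g0 := gap_lt H k0.
have [z /andP[z1 z2] ->] := F_increment H k0 (lexx _) g0 (lexx _).
have P0 : 0 < \prod_(j < n) `|z - rsubmx x 0 j|.
  apply: prodr_gt0 => j _; rewrite normr_gt0 subr_eq0.
  have [jk|jk] := ltnP j k.
    rewrite gt_eqF // (le_lt_trans _ z1) //.
    by apply: (increasing_le H.1); rewrite /= -ltnS prednK.
  by rewrite lt_eqF // (lt_le_trans z2) //; exact: (increasing_le H.1).
set P := \prod_(j < n) _ in P0 *; set g := rsubmx x 0 k - _.
have {}g0 : 0 < g by rewrite subr_gt0.
have Pg : 0 < P * g by rewrite mulr_gt0.
have [->|tn1] := eqVneq t 1; first by rewrite mul1r subrr mul0r addr0.
have t1' : 0 < 1 - t by rewrite subr_gt0 lt_neqAle tn1.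
by rewrite ltr_wpDl ?mulr_ge0 ?mulr_gt0 // ltW.
Qed.

Definition solution_bound c : R :=
  root_bound c + (\sum_k `|c 0 k| + n.+2%:R * (1 + root_bound c) ^+ (n.+1 + n)).

Lemma solution_norm c t x : solution (row_mx 0 c) t x -> 0 <= t <= 1 ->
  `|x| <= solution_bound c.
Proof.
move=> S t01; have H := solution_roots S; have G := solution_gap S.
have B0 := root_bound_ge0 c; have lB := root_le_bound H t01 G.
have s0 : 0 <= \sum_k `|c 0 k| by apply: sumr_ge0.
have p0 : 0 <= n.+2%:R * (1 + root_bound c) ^+ (n.+1 + n).
  by rewrite mulr_ge0 // exprn_ge0 // addr_ge0.
apply: norm_mx_le => [|i0 i]; first by rewrite !addr_ge0.
rewrite ord1; case: (split_ordP i) => k ->.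
  have := @coef_le_bound _ _ (lsubmx x) (rsubmx x) _ (\sum_k `|c 0 k|) B0 H lB.
  move=> h; have -> : x 0 (lshift n k) = lsubmx x 0 k by rewrite mxE.
  rewrite (le_trans (h _ k)) ?lerDr // => j j0.
  by rewrite (solution_value S j0) (bigD1 j) //= lerDl sumr_ge0.
have := lB k; rewrite mxE => /le_trans; apply.
by rewrite lerDl addr_ge0.
Qed.

(** For [t = 0] the gaps are prescribed, so two solutions have roots that differ by
    a translation, and sum 0 rules this out.  Equal roots give equal derivatives
    [F'], and the value at the first root fixes the constant term. *)
Lemma solution0_uniq c x y : solution (row_mx 0 c) 0 x -> solution (row_mx 0 c) 0 y -> x = y.
Proof.
move=> Sx Sy; have Hx := solution_roots Sx; have Hy := solution_roots Sy.
have Gx := solution_gap Sx.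
have Gy := solution_gap Sy.
have lE : rsubmx x = rsubmx y.
  have D k j : rsubmx x 0 k - rsubmx y 0 k = rsubmx x 0 j - rsubmx y 0 j.
    move: k j; suff D0 (o : 'I_n) : o = 0%N :> nat -> forall k,
        rsubmx x 0 k - rsubmx y 0 k = rsubmx x 0 o - rsubmx y 0 o.
      move=> k j; have n0 : (0 < n)%N by case: n k => [[]|].
      by rewrite (D0 (Ordinal n0)) // [RHS](D0 (Ordinal n0)).
    move=> o0; elim/prv_ind => [k k0|k k0 <-].
      by have -> : k = o by apply/val_inj; rewrite /= k0 o0.
    have := Gx k k0; have := Gy k k0; rewrite /gapeq !mul0r !add0r subr0 !mul1r.
    by move=> <- /eqP; rewrite subr_eq => /eqP ->; ring.
  apply/rowP => k; have n0 : (0 < n)%N by case: n k => [[]|].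
  have : \sum_j (rsubmx x 0 j - rsubmx y 0 j) = 0.
    by rewrite sumrB (sum_roots n0 Hx) (sum_roots n0 Hy) subrr.
  rewrite (eq_bigr (fun=> rsubmx x 0 k - rsubmx y 0 k)) => [|j _]; last exact: D.
  rewrite sumr_const card_ord => /eqP; rewrite mulrn_eq0 eqn0Ngt n0 /= subr_eq0.
  by move/eqP.
have [||k|k k0|k k0|/lower_inj/eqP + _] :=
  @linearized_kernel _ _ _ _ 0 (lower (lsubmx x - lsubmx y)) (fun=> 0) Hx.
- by rewrite lexx ler01.
- exact: size_lower.
- rewrite mulr0 addr0 -FB linearB /= -!/(Fp _) (Fp_prod Hx) (Fp_prod Hy) lE subrr.
  by rewrite horner0.
- by rewrite mul0r subrr mulr0 addr0.
- rewrite -FB hornerD hornerN (solution_value Sx k0) lE (solution_value Sy k0).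
  by rewrite subrr.
rewrite subr_eq0 => /eqP uE.
by rewrite -[x]hsubmxK -[y]hsubmxK uE lE.
Qed.

Local Notation V := 'rV[R]_(n + n).

(** Nonnegativity of this quantity is a closed condition that, as [c_k > 0], keeps
    the roots in strictly increasing order. *)
Definition gap_slack c x k : R :=
  if (0 < k)%N then
    (1 + root_bound c ^+ n) * (rsubmx x 0 k - rsubmx x 0 (prv k)) - c 0 k
  else 0.

Local Notation Z := (R * (V * (V * V)))%type.

(** Triples [(x, y, e)] over a parameter [t], where [x] and [y] are solutions and
    [e] is the unit vector along the chord from [y] to [x].  For [x <> y] the last
    condition follows from the others, since the secant of [system] maps
    [x - y] to 0.  It takes the place of [x <> y], which is not closed: for
    [x = y] it contradicts the injectivity of the linearized system. *)
Definition chords c : set Z :=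
  [set z : Z | 0 <= z.1] `&` [set z : Z | 0 <= 1 - z.1]
  `&` [set z : Z | forall i : 'I_(n + n), system z.1 z.2.1 0 i - row_mx 0 c 0 i = 0]
  `&` [set z : Z | forall i : 'I_(n + n), system z.1 z.2.2.1 0 i - row_mx 0 c 0 i = 0]
  `&` [set z : Z | forall k, 0 <= gap_slack c z.2.1 k]
  `&` [set z : Z | forall k, 0 <= gap_slack c z.2.2.1 k]
  `&` [set z : Z | 0 <= solution_bound c - `|z.2.1|]
  `&` [set z : Z | 0 <= solution_bound c - `|z.2.2.1|]
  `&` [set z : Z | `|z.2.2.2| - 1 = 0]
  `&` [set z : Z | forall i : 'I_(n + n),
        z.2.1 0 i - z.2.2.1 0 i - `|z.2.1 - z.2.2.1| * z.2.2.2 0 i = 0]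
  `&` [set z : Z | forall i : 'I_(n + n),
        system_secant z.1 z.2.1 z.2.2.1 z.2.2.2 0 i = 0].

Lemma closed_chords c : closed (chords c).
Proof.
have c1 : continuous (fun z : Z => z.1).
  by apply: cont_fst => z; exact: cvg_id.
have c2 : continuous (fun z : Z => z.2.1).
  by apply/cont_fst/cont_snd => z; exact: cvg_id.
have c3 : continuous (fun z : Z => z.2.2.1).
  by apply/cont_fst/cont_snd/cont_snd => z; exact: cvg_id.
have c4 : continuous (fun z : Z => z.2.2.2).
  by apply/cont_snd/cont_snd/cont_snd => z; exact: cvg_id.
have cn (w : Z -> V) :
  continuous w -> continuous (fun z => `|w z|).
  by move=> cw z; apply: cvg_norm; exact: cw.
have ctame (w : Z -> V) k :
  continuous w -> continuous (fun z => gap_slack c (w z) k).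
  move=> cw; rewrite /gap_slack; case: (0 < k)%N; last exact: contC.
  apply: contB; last exact: contC.
  apply: contM; first exact: contC.
  by apply: contB; under eq_fun => z do rewrite mxE; exact: cont_coord.
rewrite /chords; repeat apply: closedI.
- exact: closed_nonneg.
- by apply: closed_nonneg; apply: contB => //; exact: contC.
- by apply: closed_forall => i; apply: closed_level; apply: contB;
  [exact: cont_system|exact: contC].
- by apply: closed_forall => i; apply: closed_level; apply: contB;
  [exact: cont_system|exact: contC].
- by apply: closed_forall => k; apply: closed_nonneg; exact: ctame.
- by apply: closed_forall => k; apply: closed_nonneg; exact: ctame.
- by apply: closed_nonneg; apply: contB; [exact: contC|exact: cn].
- by apply: closed_nonneg; apply: contB; [exact: contC|exact: cn].
- by apply: closed_level; apply: contB; [exact: cn|exact: contC].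
- apply: closed_forall => i; apply: closed_level; apply: contB.
    by apply: contB; exact: cont_coord.
  apply: contM; last exact: cont_coord.
  by apply: cn => z; apply: cvgB; [exact: c2|exact: c3].
- by apply: closed_forall => i; apply: closed_level; exact: cont_system_secant.
Qed.

Lemma compact_chords c : compact (chords c).
Proof.
apply: (subclosed_compact (@closed_chords c)
  (compact_setX (@segment_compact _ 0 1)
     (compact_setX (@compact_norm_ball R (n + n) (solution_bound c))
        (compact_setX (@compact_norm_ball R (n + n) (solution_bound c))
                      (@compact_norm_ball R (n + n) 1))))).
move=> [t [x [y e]]] [[[[[[[[[[/= t0 t1] _] _] _] _] xM] yM] e1] _] _].
split; first by rewrite /= in_itv /= t0 -subr_ge0.
split; first by rewrite /= -subr_ge0.
split; first by rewrite /= -subr_ge0.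
by rewrite /= -subr_le0 e1.
Qed.

(** Distinctness of [x] and [y] is recovered from [system_secant_kernel]. *)
Lemma chords_solution c t x y e : (forall k, (0 < k)%N -> 0 < c 0 k) ->
  chords c (t, (x, (y, e))) ->
  [/\ 0 <= t <= 1, solution (row_mx 0 c) t x, solution (row_mx 0 c) t y & x != y].
Proof.
move=> c0 [[[[[[[[[[/= t0 t1] Ex] Ey] Tx] Ty] _] _] e1] _] L].
have tm (w : V) : (forall k, 0 <= gap_slack c w k) ->
   increasing (rsubmx w).
  move=> Tw; apply: increasing_gaps => k k0; have := Tw k; rewrite /gap_slack k0 subr_ge0 => h.
  have := lt_le_trans (c0 k k0) h; rewrite pmulr_rgt0 ?subr_gt0 //.
  by rewrite ltr_wpDr // exprn_ge0 // root_bound_ge0.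
have t01 : 0 <= t <= 1 by rewrite t0 -subr_ge0.
have Sx : solution (row_mx 0 c) t x.
  by split; [exact: tm|apply/rowP => i; apply/eqP; rewrite -subr_eq0 Ex].
have Sy : solution (row_mx 0 c) t y.
  by split; [exact: tm|apply/rowP => i; apply/eqP; rewrite -subr_eq0 Ey].
split=> //; apply/eqP => xy; subst y.
have /(system_secant_kernel Sx t01) e0 : system_secant t x x e = 0.
  by apply/rowP => i; rewrite L entry0.
by move/eqP: e1; rewrite e0 normr0 sub0r oppr_eq0 oner_eq0.
Qed.

Lemma solution_chords c t x y : 0 <= t <= 1 -> solution (row_mx 0 c) t x ->
  solution (row_mx 0 c) t y -> x != y ->
  chords c (t, (x, (y, `|x - y|^-1 *: (x - y)))).
Proof.
move=> t01 Sx Sy xy; case/andP: (t01) => t0 t1.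
have d0 : `|x - y| != 0 by rewrite normr_eq0 subr_eq0.
have tm (w : V) : solution (row_mx 0 c) t w -> (forall k, 0 <= gap_slack c w k).
  move=> Sw k; rewrite /gap_slack; case: ifP => // k0; rewrite subr_ge0.
  exact: (gap_lb (solution_roots Sw) t01 (solution_gap Sw)).
have tg (w : V) : solution (row_mx 0 c) t w ->
  forall i : 'I_(n + n), system t w 0 i - row_mx 0 c 0 i = 0.
  by case=> _ -> i; rewrite subrr.
split; [split; [split; [split; [split; [split; [split; [split; [split;
  [split|]|]|]|]|]|]|]|]|]; rewrite /=.
- by [].
- by rewrite subr_ge0.
- exact: tg.
- exact: tg.
- exact: tm.
- exact: tm.
- by rewrite subr_ge0 (solution_norm Sx).
- by rewrite subr_ge0 (solution_norm Sy).
- by rewrite normrZ normfV normr_id mulVf // subrr.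
- by move=> i; rewrite entryZ entryB mulrA mulfV // mul1r subrr.
- move=> i; rewrite linearZ /= -system_secantP; case: Sx => _ ->; case: Sy => _ ->.
  by rewrite subrr scaler0 entry0.
Qed.

Lemma cvg_system_matrix (t : R) x :
  system_matrix z.1 z.2.1 z.2.2 @[z --> (nbhs t, (nbhs x, nbhs x))] --> system_matrix t x x.
Proof.
apply/cvgrPdist_le => e e0.
have c1 : continuous (fun z : R * (V * V) => z.1).
  by apply: cont_fst => z; exact: cvg_id.
have c2 : continuous (fun z : R * (V * V) => z.2.1).
  by apply/cont_fst/cont_snd => z; exact: cvg_id.
have c3 : continuous (fun z : R * (V * V) => z.2.2).
  by apply/cont_snd/cont_snd => z; exact: cvg_id.
have H (i j : 'I_(n + n)) : \forall z \near (nbhs t, (nbhs x, nbhs x)),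
    `|system_matrix t x x i j - system_matrix z.1 z.2.1 z.2.2 i j| <= e.
  have := @cont_system_secant R n _ (fun z : R * (V * V) => z.1)
    (fun z => z.2.1) (fun z => z.2.2) (fun=> delta_mx 0 i) j c1 c2 c3
      (@cst_continuous _ _ _) (t, (x, x)).
  move=> /cvgrPdist_le/(_ e e0); apply: filterS => z.
  by rewrite !mxE.
have FF : Filter (filter_prod (nbhs t) (filter_prod (nbhs x) (nbhs x)))
  by exact: filter_prod_filter.
have H1 (i : 'I_(n + n)) := filter_forall FF (H i).
have := filter_forall FF H1.
apply: filterS => z Hz; apply: norm_mx_le => [|i j]; first exact: ltW.
by have := Hz i j; rewrite !mxE.
Qed.

Lemma near_increasing x0 : increasing (rsubmx x0) ->
  \forall x \near x0, increasing (rsubmx x).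
Proof.
move=> il; have FF := nbhs_filter x0.
have H k : \forall x \near x0, (0 < k)%N -> rsubmx x 0 (prv k) < rsubmx x 0 k.
  case: (posnP k) => [k0|k0]; first exact: filterE.
  have cg : continuous (fun x : V => rsubmx x 0 k - rsubmx x 0 (prv k)).
    by apply: contB; under eq_fun => z do rewrite mxE; apply: cont_coord => z; exact: cvg_id.
  have /cvgr_gt/(_ 0) := cg x0; rewrite subr_gt0 il ?prv_lt // => /(_ isT).
  by apply: filterS => x; rewrite subr_gt0.
have := filter_forall FF H; apply: filterS => x Hx.
by apply: increasing_gaps => k; exact: Hx.
Qed.

(** Continuation of a solution when the deformation parameter and the right-hand
    side depend continuously on a point [p] of any topological space. *)
Lemma near_solution (P : topologicalType) (tau : P -> R) (C : P -> V) (p0 : P) x0 c :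
  {for p0, continuous tau} -> {for p0, continuous C} -> C p0 = row_mx 0 c ->
  0 <= tau p0 <= 1 -> solution (C p0) (tau p0) x0 ->
  forall r : R, 0 < r ->
  \forall p \near p0, exists2 x, `|x - x0| <= r & solution (C p) (tau p) x.
Proof.
move=> ct cC C0 t01 S r r0.
have /nbhs_ballP[r1 /= r10 Hr1] := near_increasing S.1.
have r2 : 0 < Num.min r (r1 / 2) by rewrite lt_min r0 divr_gt0.
have cA : system_matrix (tau z.1) z.2.1 z.2.2 @[z --> (nbhs p0, (nbhs x0, nbhs x0))]
    --> system_matrix (tau p0) x0 x0.
  apply: (@cvg_comp _ _ _ (fun z : P * (V * V) => (tau z.1, z.2))
     (fun z => system_matrix z.1 z.2.1 z.2.2) _ _ _ _ (cvg_system_matrix (t := tau p0) (x :=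
       x0))).
  have F2 : Filter (filter_prod (nbhs x0) (nbhs x0)) by exact: filter_prod_filter.
  have F3 : Filter (filter_prod (nbhs p0) (filter_prod (nbhs x0) (nbhs x0))).
    exact: filter_prod_filter.
  apply: (@cvg_pair _ _ _ _ (nbhs (tau p0)) (filter_prod (nbhs x0) (nbhs x0)) F3 _ F2).
    apply: (@cvg_comp _ _ _ fst tau _ (nbhs p0) _ _ ct).
    exact: cvg_fst.
  exact: cvg_snd.
have cf : system (tau p) x0 - C p @[p --> nbhs p0] --> (0 : V).
  have -> : 0 = system (tau p0) x0 - C p0 by rewrite S.2 subrr.
  apply: cvgB; last exact: cC.
  apply: (@cvg_comp _ _ _ tau (fun t => system t x0)); first exact: ct.
  apply/cvgrPdist_le => e e0.
  have H (i : 'I_(n + n)) : \forall t \near tau p0, `|system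
    (tau p0) x0 0 i - system t x0 0 i| <= e.
    have := @cont_system R n _ (fun t :
      R => t) (fun=> x0) i (fun z => cvg_id) (@cst_continuous _ _ _) (tau p0).
    by move=> /cvgrPdist_le/(_ e e0).
  have := filter_forall (nbhs_filter (tau p0)) H; apply: filterS => t Ht.
  apply: norm_mx_le => [|a b]; first exact: ltW.
  by rewrite ord1 entryB.
have uA : system_matrix (tau p0) x0 x0 \in unitmx.
  by apply: (system_matrix_unit (c := c)) t01; rewrite -C0.
have fA (p : P) x y : (system (tau p) x - C p) - (system (tau p) y - C p)
    = (x - y) *m system_matrix (tau p) x y.
  by rewrite -system_matrixP opprB addrA subrK.
have := @solvable_near R _ P (nbhs p0) (nbhs_filter p0) (fun p x => system (tau p) x - C p)
  (fun p => system_matrix (tau p)) x0 _ fA uA cA cf _ r2; apply: filterS => p [x xr /eqP].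
rewrite subr_eq0 => /eqP xC; exists x; first by move: xr; rewrite le_min => /andP[].
split=> //; apply: Hr1; rewrite -ball_normE /ball_ /= distrC.
move: xr; rewrite le_min => /andP[_ /le_lt_trans]; apply.
by rewrite ltr_pdivrMr // ltr_pMr // ltr1n.
Qed.

(** At the least parameter [t0] that carries two distinct solutions, either [t0 = 0],
    where the solution is unique, or both solutions persist, still distinct, for
    slightly smaller parameters. *)
Lemma solution_uniq c x y : solution (row_mx 0 c) 1 x -> solution (row_mx 0 c) 1 y -> x = y.
Proof.
move=> Sx Sy; apply/eqP; apply: contrapT => /negP xy.
have t11 : 0 <= (1 : R) <= 1 by rewrite ler01 lexx.
have c0 := solution_target_gt0 Sx t11.
have ne : chords c !=set0 by eexists; apply: solution_chords t11 Sx Sy xy.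
have [|[t0 [x0 [y0 e0]]] /set_mem K0 min0] :=
  @compact_EVT_min _ R (fun z : Z => z.1) _ ne (@compact_chords c).
  by apply: continuous_subspaceT => z; apply: cvg_fst.
have [t01 Sx0 Sy0 xy0] := chords_solution c0 K0.
have [tz|tn0] := eqVneq t0 0.
  by subst t0; move: xy0; rewrite (solution0_uniq Sx0 Sy0) eqxx.
have t0gt : 0 < t0 by rewrite lt_neqAle eq_sym tn0; case/andP: t01.
(* Balls of a third of the distance keep the two continuations apart. *)
have d0 : 0 < `|x0 - y0| / 3 by rewrite divr_gt0 // normr_gt0 subr_eq0.
have N1 := @near_solution R id (fun=> row_mx 0 c) t0 x0 c (@cvg_id _ _)
  (@cst_continuous _ _ _ _)
  erefl t01 Sx0 _ d0.
have N2 := @near_solution R id (fun=> row_mx 0 c) t0 y0 c (@cvg_id _ _)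
  (@cst_continuous _ _ _ _)
  erefl t01 Sy0 _ d0.
have [r /= r0 Hr] := (nbhs_ballP _ _).1 (filterI N1 N2).
(* A parameter in [[0, t0[] at which both continuations exist. *)
pose t := t0 - Num.min r t0 / 2.
have m0 : 0 < Num.min r t0 by rewrite lt_min r0 t0gt.
have mt : Num.min r t0 <= t0 by rewrite ge_min lexx orbT.
have mr : Num.min r t0 <= r by rewrite ge_min lexx.
have tt : t < t0 by rewrite /t; lra.
have t01' : 0 <= t <= 1 by case/andP: t01 => h1 h2; rewrite /t; apply/andP; split; lra.
have [|[x1 x1d Sx1] [y1 y1d Sy1]] := Hr t.
  by rewrite -ball_normE /ball_ /= /t opprB addrC subrK ger0_norm; lra.
have xy1 : x1 != y1.
  apply/eqP => e; subst y1.
  have : `|x0 - y0| <= `|x0 - x1| + `|x1 - y0| by exact: ler_distD.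
  by move: d0; rewrite (distrC x0 x1); lra.
have := min0 _ (mem_set (solution_chords t01' Sx1 Sy1 xy1)).
by rewrite /= leNgt tt.
Qed.

End Uniqueness.

(** * The critical values as coordinates *)

Section CriticalValues.
Variables (R : realType) (n : nat).
Implicit Types (u v w l r : 'rV[R]_n) (i j k : 'I_n).
Local Notation V := 'rV[R]_(n + n).

(** The second block of [system 1] at a point with critical values [r]. *)
Definition gap_coords r : 'rV[R]_n :=
  \row_k if k == 0%N :> nat then r 0 k else gapsign R k * (r 0 k - r 0 (prv k)).

Lemma gap_coords_inj : injective gap_coords.
Proof.
move=> r r' /rowP E; apply/rowP; elim/prv_ind => [k k0|k k0 IH]; have := E k.
  by rewrite !entry_row k0 eqxx.
rewrite !entry_row eqn0Ngt k0 IH => /(congr1 ( *%R (gapsign R k))).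
by rewrite !mulrA gapsignK !mul1r => /addIr.
Qed.

Lemma gap_coordsP a r r' : gap_coords (a *: r + r') = a *: gap_coords r + gap_coords r'.
Proof.
apply/rowP => k; rewrite entry_lin !entry_row !entry_lin; case: ifP => // _.
by ring.
Qed.

Definition with_roots u : V := row_mx u (\row_k lambda k u).

Lemma hyperbolic_roots u : u \in @hyperbolic R n ->
  ordered_roots u (\row_k lambda k u).
Proof.
rewrite inE => -[l H]; rewrite (_ : \row__ _ = l) //.
by apply/rowP => k; rewrite entry_row (lambdaP H).
Qed.

Lemma gapeq1 u l k : gapeq 1 u l k = gapsign R k * ((F u).[l 0 k] - (F u).[l 0 (prv k)]).
Proof. by rewrite /gapeq mul1r subrr mul0r addr0. Qed.

Lemma with_roots_solution u : u \in @hyperbolic R n ->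
  solution (row_mx 0 (gap_coords (critval u))) 1 (with_roots u).
Proof.
move=> /hyperbolic_roots H; split; first by rewrite row_mxKr; case: H.
rewrite /system row_mxKl row_mxKr; congr row_mx; apply/rowP => k; rewrite !entry_row.
  by rewrite entry0; have /rootP := H.2 k; rewrite entry_row.
by rewrite gapeq1 !entry_row.
Qed.

Lemma solution_hyperbolic r x : solution (row_mx 0 (gap_coords r)) 1 x ->
  [/\ lsubmx x \in @hyperbolic R n, critval (lsubmx x) = r
    & x = with_roots (lsubmx x)].
Proof.
move=> S; have H := solution_roots S.
have lE : rsubmx x = \row_k lambda k (lsubmx x).
  by apply/rowP => k; rewrite entry_row (lambdaP H).
split; first by rewrite inE; exists (rsubmx x).
  apply: gap_coords_inj; apply/rowP => k; rewrite [LHS]entry_row !entry_row !(lambdaP H).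
  case: ifP => k0.
    by rewrite (solution_value S (eqP k0)) entry_row k0.
  by rewrite -gapeq1 (solution_gap S) ?lt0n ?k0 // entry_row k0.
by rewrite /with_roots -lE hsubmxK.
Qed.

Lemma critval_inj : {in @hyperbolic R n &, injective (@critval R n)}.
Proof.
move=> u v hu hv E; have Su := with_roots_solution hu.
have Sv := with_roots_solution hv; rewrite -E in Sv.
by have /eq_row_mx[] := solution_uniq Su Sv.
Qed.

Lemma of_critvalK u : u \in @hyperbolic R n -> of_critval (critval u) = u.
Proof. exact: pinvKV critval_inj u. Qed.

Definition roots_of_critval r : V := with_roots (of_critval r).

(** Continuation with [t = 1] and right-hand side [r] produces solutions close to
    the given one; by uniqueness they are the values of [roots_of_critval]. *)
Lemma near_of_critval u : u \in @hyperbolic R n -> forall e : R, 0 < e ->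
  \forall r \near critval u, `|roots_of_critval r - roots_of_critval (critval u)| <= e
   /\ solution (row_mx 0 (gap_coords r)) 1 (roots_of_critval r).
Proof.
move=> hu e e0; have t11 : 0 <= (1 : R) <= 1 by rewrite ler01 lexx.
have cC : continuous (fun r : 'rV[R]_n => row_mx 0 (gap_coords r) : V).
  move=> r; apply/(@cvgrPdist_le _ _ _ _ (nbhs_filter r)) => d d0.
  have H (i : 'I_(n + n)) : \forall r' \near r,
      `|(row_mx 0 (gap_coords r) : V) 0 i - (row_mx 0 (gap_coords r') : V) 0 i| <= d.
    have : continuous (fun r' : 'rV[R]_n => (row_mx 0 (gap_coords r') : V) 0 i).
      case: (split_ordP i) => k ->.
        by under eq_fun => z do rewrite row_mxEl; exact: contC.
      under eq_fun => z do rewrite row_mxEr entry_row.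
      case: (k == 0%N :> nat); first by apply: cont_coord => z; exact: cvg_id.
      apply: contM; first exact: contC.
      by apply: contB; apply: cont_coord => z; exact: cvg_id.
    by move=> /(_ r) /cvgrPdist_le/(_ d d0).
  have := filter_forall (nbhs_filter r) H; apply: filterS => r' Hr'.
  apply: norm_mx_le => [|a b]; first exact: ltW.
  by rewrite ord1 entryB.
have := @near_solution R n _ (fun=> 1) (fun r => row_mx 0 (gap_coords r)) (critval u)
  (with_roots u) _ (@cst_continuous _ _ _ _) (cC _) erefl t11 (with_roots_solution hu) e e0.
apply: filterS => r [x xe Sx].
have [hx cx xE] := solution_hyperbolic Sx.
have rx : roots_of_critval r = x by rewrite /roots_of_critval -cx of_critvalK.
by rewrite rx /roots_of_critval of_critvalK.
Qed.

Lemma near_of_critval_hyperbolic u : u \in @hyperbolic R n ->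
  \forall r \near critval u, of_critval r \in @hyperbolic R n
    /\ critval (of_critval r) = r.
Proof.
move=> hu; have := near_of_critval hu ltr01; apply: filterS => r [_ S].
by have [] := solution_hyperbolic S; rewrite row_mxKl.
Qed.

End CriticalValues.

(** * Differentiability of the inverse *)

Section LinearSolve.
Variables (R : realType) (N : nat).

(** Continuity of the solution of a linear system in its matrix: with
    [z0 = W A0^-1] one has [z0 - z = z (A - A0) A0^-1], whose norm is at most a
    small multiple of [|z0 - z| + |z0|]. *)
Lemma cvg_solve (T : Type) (Flt : set_system T) (FF : Filter Flt)
    (A : T -> 'M[R]_N) (A0 : 'M[R]_N) (z : T -> 'rV[R]_N) (W : 'rV[R]_N) :
  A0 \in unitmx -> A x @[x --> Flt] --> A0 ->
  (\forall x \near Flt, z x *m A x = W) ->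
  z x @[x --> Flt] --> W *m invmx A0.
Proof.
move=> uA cA zA; set M := invmx A0; set z0 := W *m M.
apply/cvgrPdist_le => e e0.
pose K := N%:R * (N%:R * `|M|).
have K0 : 0 <= K by rewrite !mulr_ge0.
(* The first bound absorbs [|z0 - z|] into the left-hand side, the second makes
   the remaining multiple of [|z0|] smaller than [e]. *)
pose d := Num.min (2 * (K + 1))^-1 (e / (2 * (K + 1) * (`|z0| + 1))).
have K1 : 0 < K + 1 by rewrite ltr_wpDl.
have z1 : 0 < `|z0| + 1 by rewrite ltr_wpDl.
have d0 : 0 < d by rewrite lt_min invr_gt0 divr_gt0 // !mulr_gt0.
have nA : \forall x \near Flt, `|A0 - A x| < d by exact: (cvgrPdist_lt _ _).1 cA d d0.
apply: filterS2 zA nA => x zx Ax.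
have E : z0 - z x = z x *m ((A x - A0) *m M).
  by rewrite mulmxA mulmxBr zx mulmxBl -/z0 mulmxK.
have h1 : `|z0 - z x| <= `|z x| * (K * d).
  rewrite E (le_trans (norm_mulmx _ _)) //.
  apply: le_trans (_ : N%:R * `|z x| * (N%:R * d * `|M|) <= _).
    rewrite ler_wpM2l ?mulr_ge0 // (le_trans (norm_mulmx _ _)) // ler_wpM2r // ler_wpM2l //.
    by rewrite distrC ltW.
  by rewrite le_eqVlt; apply/orP; left; apply/eqP; rewrite /K; ring.
have h2 : `|z x| <= `|z0 - z x| + `|z0|.
  by have := ler_normB z0 (z0 - z x); rewrite opprB addrCA subrr addr0 [leRHS]addrC.
have Kd : K * d <= 1 / 2.
  apply: le_trans (_ : (K + 1) * (2 * (K + 1))^-1 <= _).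
    by rewrite ler_pM ?(ltW d0) // ?lerDl // ge_min lexx.
  by rewrite invfM mulrCA mulfV ?gt_eqF // mulr1 div1r.
have Kd2 : K * d * (2 * (`|z0| + 1)) <= e.
  apply: le_trans (_ : (K + 1) * (e / (2 * (K + 1) * (`|z0| + 1))) * (2 * (`|z0| + 1)) <= _).
    rewrite ler_wpM2r ?mulr_ge0 ?(ltW z1) // ler_pM ?(ltW d0) // ?lerDl //.
    by rewrite ge_min lexx orbT.
  by rewrite le_eqVlt; apply/orP; left; apply/eqP; field; rewrite !gt_eqF.
have Kd0 : 0 <= K * d by rewrite mulr_ge0 // ltW.
have n0 : 0 <= `|z0 - z x| by [].
have := ler_wpM2r Kd0 h2; move: h1 Kd Kd2 Kd0 n0.
set a := `|z0 - z x|; set b := `|z x|; set g := `|z0|; set q := K * d.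
move=> h1 Kd Kd2 Kd0 n0 h3.
have h4 : a * q <= a * (1 / 2) by rewrite ler_wpM2l.
nra.
Qed.

End LinearSolve.

Section Derivatives.
Variables (R : realType) (n : nat).
Implicit Types (u v w l r : 'rV[R]_n) (i j k : 'I_n).
Local Notation V := 'rV[R]_(n + n).

(** The difference quotient of [(u, l)] along [w] solves a linear system whose
    matrix, the secant of [system], tends to its value on the diagonal, and whose
    right-hand side is constant because [gap_coords] is linear. *)
Lemma is_derive_roots u w : u \in @hyperbolic R n ->
  exists z : V, system_secant 1 (with_roots u) (with_roots u) z = row_mx 0 (gap_coords w)
  /\ forall i : 'I_(n + n),
     is_derive (critval u) w (fun r => roots_of_critval r 0 i : R^o) (z 0 i).
Proof.
move=> hu; set r0 := critval u; set x0 := with_roots u.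
have rx0 : roots_of_critval r0 = x0 by rewrite /roots_of_critval of_critvalK.
have t11 : 0 <= (1 : R) <= 1 by rewrite ler01 lexx.
pose W : V := row_mx 0 (gap_coords w).
pose A0 := system_matrix 1 x0 x0.
have S0 := with_roots_solution hu; rewrite -/x0 -/r0 in S0.
have uA : A0 \in unitmx by exact: system_matrix_unit S0 t11.
pose y (h : R) : V := roots_of_critval (h *: w + r0).
have ch : (h *: w + r0) @[h --> (0 : R)] --> r0.
  rewrite -[X in _ --> X]add0r -(scale0r w); apply: cvgD; last exact: cvg_cst.
  by apply: cvgZr_tmp; exact: cvg_id.
have near_y (e : R) : 0 < e -> \forall h \near (0 : R), `|y h - x0| <= e
    /\ solution (row_mx 0 (gap_coords (h *: w + r0))) 1 (y h).
  by move=> e0; rewrite -rx0; exact: (ch _ (near_of_critval hu e0)).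
have cy : y h @[h --> (0 : R)^'] --> x0.
  apply: cvg_within_filter; apply/cvgrPdist_le => e e0.
  by have := near_y e e0; apply: filterS => h [hy _]; rewrite distrC.
have cA : system_matrix 1 (y h) x0 @[h --> (0 : R)^'] --> A0.
  apply: (@cvg_comp _ _ _ (fun h => (1 : R, (y h, x0)))
     (fun z : R * (V * V) => system_matrix z.1 z.2.1 z.2.2) _ _ _ _
     (cvg_system_matrix (t := 1) (x := x0))).
  have Fd : Filter ((0 : R)^') by exact: dnbhs_filter.
  have F2 : Filter (filter_prod (nbhs x0) (nbhs x0)) by exact: filter_prod_filter.
  apply: (@cvg_pair _ _ _ _ (nbhs (1 : R)) (filter_prod (nbhs x0) (nbhs x0)) Fd _ F2).
    exact: cvg_cst.
  by apply: (@cvg_pair _ _ _ _ (nbhs x0) (nbhs x0) Fd _ _); [exact: cy|exact: cvg_cst].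
pose zz (h : R) : V := h^-1 *: (y h - x0).
have zA : \forall h \near (0 : R)^', zz h *m system_matrix 1 (y h) x0 = W.
  have h1 : \forall h \near (0 : R)^', h != 0 by exact: nbhs_dnbhs_neq.
  have h2 : \forall h \near (0 : R)^', solution (row_mx 0 (gap_coords (h *: w + r0))) 1 (y h).
    apply: (cvg_within (F := nbhs (0 : R))).
    by have := near_y 1 ltr01; apply: filterS => h [].
  apply: filterS2 h1 h2 => h h0 [_ Sy].
  rewrite -scalemxAl -system_matrixP Sy S0.2 gap_coordsP opp_row_mx add_row_mx oppr0 addr0.
  by rewrite addrK scale_row_mx scaler0 scalerA mulVf // scale1r.
exists (W *m invmx A0); split; first by rewrite -mul_system_matrix mulmxKV.
move=> i; have cz := @cvg_solve R _ _ _ (dnbhs_filter (0 : R)) _ _ _ _ uA cA zA.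
have ci : zz h 0 i @[h --> (0 : R)^'] --> (W *m invmx A0) 0 i.
  have h0 := @coord_continuous R 1 (n + n) 0 i (W *m invmx A0).
  exact: continuous_cvg _ h0 cz.
have Ei : (fun h => h^-1 *: (((fun r => roots_of_critval r 0 i : R^o) \o shift r0) (h *: w)
     - roots_of_critval r0 0 i)) = (fun h => zz h 0 i).
  by apply/funext => h; rewrite /zz /= entryZ entryB rx0.
by apply: DeriveDef; [rewrite /derivable Ei; apply: cvgP ci|rewrite /derive Ei;
  exact: cvg_lim ci].
Qed.

End Derivatives.

(** * Directional derivatives of polynomial expressions *)

Section Calculus.
Variables (R : realType) (V : normedModType R).
Implicit Types (f g : V -> R^o) (x w : V).

Lemma is_derive_fun_sum m (f : 'I_m -> V -> R^o) (df : 'I_m -> R) x w :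
  (forall i, is_derive x w (f i) (df i)) ->
  is_derive x w (fun v => \sum_(i < m) f i v : R^o) (\sum_(i < m) df i).
Proof.
move=> H; have := is_derive_sum H.
by rewrite (_ : \sum_(i < m) f i = fun v => \sum_(i < m) f i v) // -fct_sumE.
Qed.

Lemma is_derive_fun_mul f g (df dg : R) x w :
  is_derive x w f df -> is_derive x w g dg ->
  is_derive x w (fun v => f v * g v : R^o) (df * g x + f x * dg).
Proof.
move=> Hf Hg; have := is_deriveM Hf Hg; rewrite -[_ *: dg]/(_ * _) -[_ *: df]/(_ * _).
by rewrite addrC [g x * df]mulrC.
Qed.

Lemma is_derive_fun_exp f (df : R) x w m : is_derive x w f df ->
  is_derive x w (fun v => f v ^+ m : R^o) (m%:R * f x ^+ m.-1 * df).
Proof.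
move=> Hf; have := is_deriveX m Hf; rewrite -[_ *: df]/(_ * _).
by rewrite (_ : f ^+ m = fun v => f v ^+ m) // exprfctE.
Qed.

Lemma is_derive_scale f (c df : R) x w : is_derive x w f df ->
  is_derive x w (fun v => f v * c : R^o) (df * c).
Proof.
by move=> Hf; have := is_derive_fun_mul Hf (is_derive_cst (c : R^o) x w); rewrite mulr0 addr0.
Qed.

Lemma is_derive_horner N (p : V -> {poly R}) (dp : {poly R}) (b : V -> R^o) (db : R) x w :
  (forall v, size (p v) <= N)%N -> (size dp <= N)%N ->
  (forall m, is_derive x w (fun v => (p v)`_m : R^o) dp`_m) ->
  is_derive x w b db ->
  is_derive x w (fun v => (p v).[b v] : R^o) (dp.[b x] + (p x)^`().[b x] * db).
Proof.
move=> sp sdp Hp Hb.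
rewrite (_ : (fun v => _) = fun v => \sum_(m < N) (p v)`_m * b v ^+ m); last first.
  by apply/funext => v; rewrite (horner_coef_wide _ (sp v)).
have -> : dp.[b x] + (p x)^`().[b x] * db
    = \sum_(m < N) (dp`_m * b x ^+ m + (p x)`_m * (m%:R * b x ^+ m.-1 * db)).
  rewrite big_split /= -(horner_coef_wide _ sdp); congr (_ + _).
  rewrite -(secant_diag _ (sp x)) /secant mulr_suml; apply: eq_bigr => m _.
  rewrite -[LHS]mulrA; congr (_ * _); congr (_ * _); case: m => -[|m] mN /=;
    first by rewrite big_ord0 mul0r.
  rewrite (eq_bigr (fun=> b x ^+ m)) ?sumr_const ?card_ord ?mulr_natl // => j _.
  by rewrite -exprD subnK // -ltnS.
apply: is_derive_fun_sum => m; apply: is_derive_fun_mul => //.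
exact: is_derive_fun_exp.
Qed.

Lemma is_derive_coef_deriv (p : V -> {poly R}) (dp : {poly R}) x w :
  (forall m, is_derive x w (fun v => (p v)`_m : R^o) dp`_m) ->
  forall m, is_derive x w (fun v => (p v)^`()`_m : R^o) dp^`()`_m.
Proof.
move=> Hp m; rewrite coef_deriv -mulr_natr.
under eq_fun => v do rewrite coef_deriv -mulr_natr.
exact: is_derive_scale.
Qed.

Lemma is_derive_coef_F n (u : V -> 'rV[R]_n) (du : 'rV[R]_n) x w :
  (forall k, is_derive x w (fun v => u v 0 k : R^o) (du 0 k)) ->
  forall m, is_derive x w (fun v => (F (u v))`_m : R^o) (lower du)`_m.
Proof.
move=> Hu m; under eq_fun => v do rewrite FE coefD coef_lower.
have Hs : is_derive x w (fun v => \sum_(k < n) u v 0 k * (m == (n.-1 - k)%N)%:R :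
  R^o) (lower du)`_m.
  by rewrite coef_lower; apply: is_derive_fun_sum => k; exact: is_derive_scale.
have := is_deriveD (is_derive_cst (((n.+1%:R)^-1 *: 'X^(n.+1) : {poly R})`_m : R^o) x w) Hs.
by rewrite add0r.
Qed.

Lemma is_derive_line f (df : R) x w :
  is_derive x w f df <-> is_derive (0 : R) 1 (fun h => f (h *: w + x) : R^o) df.
Proof.
have E : (fun h : R => h^-1 *: ((f \o shift x) (h *: w) - f x))
    = (fun h : R => h^-1 *: (((fun h => f (h *: w + x)) \o shift 0) (h *: (1 : R))
                             - f (0 *: w + x))).
  by apply/funext => h /=; rewrite addr0 scale0r add0r [_%:A]mulr1.
split=> -[D <-]; apply: DeriveDef.
- by rewrite /derivable -E.
- by rewrite /derive -E.
- by rewrite /derivable E.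
- by rewrite /derive E.
Qed.

(** Near [x] the sign [s] of [f] is constant, so that [|f| = f s] there. *)
Lemma is_derive_ln_norm f (df : R) x w : f x != 0 -> is_derive x w f df ->
  is_derive x w (fun v => ln `|f v| : R^o) (df / f x).
Proof.
move=> fx0 Hf.
pose s := Num.sg (f x); pose g (h : R) : R := f (h *: w + x) * s.
have s0 : s != 0 by rewrite sgr_eq0.
have g0 : 0 < g 0 by rewrite /g scale0r add0r /s mulrC -normrEsg normr_gt0.
have Hfs : is_derive x w (fun v => f v * s : R^o) (df * s) by exact: is_derive_scale.
have Dg : is_derive (0 : R) 1 (g : R -> R^o) (df * s).
  exact: (is_derive_line (fun v => f v * s) _ _ _).1 Hfs.
have near_g : \forall h \near (0 : R), 0 < g h.
  have : {for (0 : R), continuous (g : R -> R)}.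
    by apply: differentiable_continuous; apply/derivable1_diffP; case: Dg.
  by move=> /cvgr_gt/(_ 0 g0).
have Dl := @is_derive1_comp R (@ln R) g 0 _ _ (is_derive1_ln g0) Dg.
have E : (g 0)^-1 * (df * s) = df / f x.
  by rewrite /g scale0r add0r; field; rewrite fx0 s0.
rewrite E in Dl.
have lnE h : 0 < g h -> ln (g h) = ln `|f (h *: w + x)|.
  rewrite /g => gh; congr ln; rewrite -(gtr0_norm gh) normrM.
  by rewrite /s normr_sg fx0 mulr1.
apply/is_derive_line.
by apply: near_eq_is_derive Dl; apply: filterS near_g => h; exact: lnE.
Qed.

End Calculus.

(** * Variations along a coordinate line *)

Section Variation.
Variables (R : realType) (n : nat).
Implicit Types (u v w l r : 'rV[R]_n) (i j k : 'I_n).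
Local Notation V := 'rV[R]_(n + n).

(** The first conclusion is the envelope identity: as [F'] vanishes at the root, the
    motion of the root does not contribute to the variation of the critical
    value.  The second is the derivative of [F'(l_k) = 0]. *)
Lemma secant_solution u (z : V) w : u \in @hyperbolic R n ->
  system_secant 1 (with_roots u) (with_roots u) z = row_mx 0 (gap_coords w) ->
  (forall k, (lower (lsubmx z)).[lambda k u] = w 0 k) /\
  (forall k, (lower (lsubmx z))^`().[lambda k u] + (Fpp u).[lambda k u] * rsubmx z 0 k = 0).
Proof.
move=> hu; have H := hyperbolic_roots hu.
have rE k : (\row_i lambda i u) 0 k = lambda k u by rewrite entry_row.
move=> /eq_row_mx[/rowP E1 /rowP E2].
have vE k : value_secant (with_roots u) (with_roots u) z k = (lower (lsubmx z)).[lambda k u].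
  rewrite /value_secant row_mxKl row_mxKr secant_diag ?size_F // -/(Fp _).
  by have /rootP -> := H.2 k; rewrite mulr0 addr0 rE.
split=> k.
  suff -> : w = \row_k (lower (lsubmx z)).[lambda k u] by rewrite entry_row.
  apply: gap_coords_inj; apply/rowP => m; rewrite -E2 !entry_row !vE.
  by rewrite mul1r subrr mul0r addr0.
have := E1 k; rewrite entry_row entry0 /slope_secant row_mxKl row_mxKr.
by rewrite secant_diag ?size_Fp // -FppE rE [_ * rsubmx z 0 k]mulrC.
Qed.

(** Up to the factor [F_pp(lambda_j)], the [j]-th Lagrange polynomial for the
    critical points. *)
Definition omit_root u j : {poly R} := \prod_(k < n | k != j) ('X - (lambda k u)%:P).

Lemma Fp_omit_root u j : u \in @hyperbolic R n ->
  Fp u = ('X - (lambda j u)%:P) * omit_root u j.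
Proof.
move=> hu; rewrite (Fp_prod (hyperbolic_roots hu)) (bigD1 j) //= entry_row.
by congr (_ * _); apply: eq_bigr => k _; rewrite entry_row.
Qed.

Lemma omit_root_diag u j : u \in @hyperbolic R n ->
  (omit_root u j).[lambda j u] = (Fpp u).[lambda j u].
Proof.
move=> hu; rewrite FppE (Fp_omit_root j hu) derivM derivXsubC mul1r hornerD hornerM.
by rewrite hornerXsubC subrr mul0r addr0.
Qed.

Lemma omit_root_off u i j : j != i -> (omit_root u j).[lambda i u] = 0.
Proof.
move=> ji; apply/rootP; rewrite /omit_root (bigD1 i) //=; last by rewrite eq_sym.
by rewrite rootM root_XsubC eqxx.
Qed.

Lemma monic_omit_root u j : u \in @hyperbolic R n ->
  size (omit_root u j) = n /\ (omit_root u j)`_n.-1 = 1.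
Proof.
move=> hu; have E := Fp_omit_root j hu.
have Q0 : omit_root u j != 0.
  by apply: contra_eqN E => /eqP ->; rewrite mulr0 -size_poly_eq0 size_Fp.
have s : size (omit_root u j) = n.
  by have := size_Fp u; rewrite E size_monicM ?monicXsubC // size_XsubC add2n => -[].
split=> //; have := monic_Fp u; rewrite E lead_coefM lead_coefXsubC mul1r.
by rewrite lead_coefE s.
Qed.

(** Both sides have degree less than [n] and agree at the [n] critical points. *)
Lemma lower_lagrange u j v : u \in @hyperbolic R n ->
  (forall k, (lower v).[lambda k u] = (delta_mx 0 j : 'rV[R]_n) 0 k) ->
  lower v = ((Fpp u).[lambda j u])^-1 *: omit_root u j.
Proof.
move=> hu E; have H := hyperbolic_roots hu.
have F0 : (Fpp u).[lambda j u] != 0 by have := Fpp_root_neq0 j H; rewrite entry_row.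
apply/eqP; rewrite -subr_eq0; apply/eqP.
apply: (poly_eq0_increasing H.1) => [k|].
  rewrite entry_row hornerD hornerN hornerZ E mxE eqxx /=.
  have [->|kj] := eqVneq k j; first by rewrite omit_root_diag // mulVf // subrr.
  by rewrite omit_root_off ?mulr0 ?subr0 // eq_sym.
rewrite (leq_trans (size_polyD _ _)) // geq_max size_lower size_polyN.
by rewrite (leq_trans (size_scale_leq _ _)) // (monic_omit_root j hu).1.
Qed.

Lemma Fpp_omit_root u i j : u \in @hyperbolic R n -> j != i ->
  (Fpp u).[lambda i u] = (lambda i u - lambda j u) * (omit_root u j)^`().[lambda i u].
Proof.
move=> hu ji; rewrite FppE (Fp_omit_root j hu) derivM derivXsubC mul1r hornerD hornerM.
by rewrite hornerXsubC omit_root_off // add0r.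
Qed.

Lemma Fppp_omit_root u i j : u \in @hyperbolic R n ->
  (Fpp u)^`().[lambda i u] = (omit_root u j)^`().[lambda i u] *+ 2
     + (lambda i u - lambda j u) * (omit_root u j)^`()^`().[lambda i u].
Proof.
move=> hu; rewrite FppE (Fp_omit_root j hu) derivM derivXsubC mul1r derivD derivM derivXsubC
  mul1r.
by rewrite hornerD [X in _ + X]hornerD hornerM hornerXsubC mulr2n addrA.
Qed.

Lemma is_derive_of_critval u j : u \in @hyperbolic R n ->
  exists z : V, [/\ forall k, is_derive (critval u) (delta_mx 0 j : 'rV[R]_n)
                     (fun r => of_critval r 0 k : R^o) (lsubmx z 0 k),
    forall k, is_derive (critval u) (delta_mx 0 j : 'rV[R]_n)
                     (fun r => lambda k (of_critval r) : R^o) (rsubmx z 0 k),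
    lower (lsubmx z) = ((Fpp u).[lambda j u])^-1 *: omit_root u j
   & forall k, (lower (lsubmx z))^`().[lambda k u] + (Fpp u).[lambda k u] * rsubmx z 0 k = 0].
Proof.
move=> hu; have [z [Ez Dz]] := is_derive_roots (delta_mx 0 j) hu.
have [E1 E2] := secant_solution hu Ez.
exists z; split=> //; last exact: lower_lagrange.
- move=> k; have := Dz (lshift n k); rewrite mxE.
  by under eq_fun do rewrite row_mxEl.
- move=> k; have := Dz (rshift n k); rewrite mxE.
  by under eq_fun do rewrite row_mxEr entry_row.
Qed.

Lemma lambda_neq u i j : u \in @hyperbolic R n -> j != i -> lambda i u - lambda j u != 0.
Proof.
move=> /hyperbolic_roots[il _] ji; rewrite subr_eq0; apply: contraNneq ji => e.
by apply/eqP/(increasing_inj il); rewrite !entry_row.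
Qed.

Lemma Fpp_lambda_neq0 u i : u \in @hyperbolic R n -> (Fpp u).[lambda i u] != 0.
Proof. by move=> /hyperbolic_roots/(Fpp_root_neq0 i); rewrite entry_row. Qed.

Lemma is_derive_coord1 (n0 : (0 < n)%N) u j : u \in @hyperbolic R n ->
  is_derive (critval u) (delta_mx 0 j : 'rV[R]_n) (coord1 n0 \o @of_critval R n : _ -> R^o)
    ((Fpp u).[lambda j u])^-1.
Proof.
move=> hu; have [z [D1 _ E _]] := is_derive_of_critval j hu.
have := D1 (Ordinal n0); rewrite -coef_lower_rev E coefZ subn0.
by rewrite (monic_omit_root j hu).2 mulr1.
Qed.

(** The derivative is [- q'(lambda_i) / F_pp(lambda_i)] with
    [q = Q / F_pp(lambda_j)], and
    [F_pp(lambda_i) = (lambda_i - lambda_j) Q'(lambda_i)]. *)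
Lemma is_derive_lambda u i j : u \in @hyperbolic R n -> j != i ->
  is_derive (critval u) (delta_mx 0 j : 'rV[R]_n) (lambda i \o @of_critval R n : _ -> R^o)
    (- (((Fpp u).[lambda j u])^-1 / (lambda i u - lambda j u))).
Proof.
move=> hu ji; have [z [_ D2 E E2]] := is_derive_of_critval j hu.
have := D2 i; congr is_derive; have := E2 i; rewrite E derivZ hornerZ.
have := Fpp_lambda_neq0 i hu; have := lambda_neq hu ji; have := Fpp_lambda_neq0 j hu.
rewrite (Fpp_omit_root hu ji); set A := (Fpp u).[_]; set D := _ - _; set Q := _.[_];
  set a := rsubmx z 0 i.
move=> A0 D0; rewrite mulf_eq0 negb_or D0 /= => Q0 e.
apply: (mulfI (_ : D * Q != 0)); first by rewrite mulf_neq0.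
move/eqP: e; rewrite addrC addr_eq0 => /eqP ->; field.
by rewrite A0 D0.
Qed.

(** By the chain rule the derivative is [q'' + F_ppp lambda_i'] at [lambda_i].  With
    [D = lambda_i - lambda_j] and [A = F_pp(lambda_j)] one has [q'' = Q'' / A],
    [F_ppp = 2 Q' + D Q''] and [lambda_i' = - 1 / (A D)], so the terms in [Q'']
    cancel and [- 2 Q' / (A D)] is left, where [Q' = F_pp(lambda_i) / D]. *)
Lemma is_derive_Fpp u i j : u \in @hyperbolic R n -> j != i ->
  is_derive (critval u) (delta_mx 0 j : 'rV[R]_n)
    (fun r => (Fpp (of_critval r)).[lambda i (of_critval r)] : R^o)
    (- (2 * (Fpp u).[lambda i u] / ((Fpp u).[lambda j u] * (lambda i u - lambda j u) ^+ 2))).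
Proof.
move=> hu ji; have [z [D1 _ E _]] := is_derive_of_critval j hu.
have D2 := is_derive_lambda hu ji.
have sF v : (size (Fpp v) <= n.+1)%N.
  by rewrite FppE (leq_trans (size_deriv_le _)) // size_Fp.
have sl : (size (lower (lsubmx z))^`()^`() <= n.+1)%N.
  do 2! rewrite (leq_trans (size_deriv_le _)) // (leq_trans (leq_pred _)) //.
  by rewrite (leq_trans (size_lower _)).
have HF : forall m, is_derive (critval u) (delta_mx 0 j : 'rV[R]_n)
   (fun r => (Fpp (of_critval r))`_m : R^o) (lower (lsubmx z))^`()^`()`_m.
  have FppE2 r : Fpp (of_critval r) = (F (of_critval r))^`()^`() :> {poly R} by rewrite FppE.
  move=> m; under eq_fun => r do rewrite FppE2.
  by apply: is_derive_coef_deriv; apply: is_derive_coef_deriv; exact: is_derive_coef_F.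
have := is_derive_horner (fun r => sF (of_critval r)) sl HF D2.
rewrite /= of_critvalK //; congr is_derive.
have := Fpp_lambda_neq0 i hu; have := lambda_neq hu ji; have := Fpp_lambda_neq0 j hu.
rewrite E !derivZ hornerZ (Fppp_omit_root i j hu) (Fpp_omit_root hu ji).
set A := (Fpp u).[_]; set D := _ - _; set Q := _^`().[_]; set Q2 := _.[_].
move=> A0 D0 _; field.
by rewrite A0 D0.
Qed.

End Variation.

(** * The functions [G] *)

Section PartialDerivatives.
Variables (R : realType) (n : nat) (n0 : (0 < n)%N).
Implicit Types (u v r : 'rV[R]_n) (i j k : 'I_n).

Lemma pdr_coord1 u i : u \in @hyperbolic R n ->
  pdr i (coord1 n0) u = ((Fpp u).[lambda i u])^-1.
Proof. by move=> hu; case: (is_derive_coord1 n0 i hu). Qed.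

Lemma G_hyperbolic u i : u \in @hyperbolic R n ->
  G n0 i u = 2^-1 * ln `|(Fpp u).[lambda i u]|.
Proof.
move=> hu; rewrite /G pdr_coord1 // normfV lnV ?mulrN ?opprK // posrE normr_gt0.
exact: Fpp_lambda_neq0.
Qed.

Lemma is_derive_pdr_coord1 u i j : u \in @hyperbolic R n -> j != i ->
  is_derive (critval u) (delta_mx 0 j : 'rV[R]_n)
    (pdr i (coord1 n0) \o @of_critval R n : _ -> R^o)
    (2 / ((Fpp u).[lambda i u] * (Fpp u).[lambda j u] * (lambda i u - lambda j u) ^+ 2)).
Proof.
move=> hu ji; have [D1 D2] := is_derive_Fpp hu ji.
have Fi := Fpp_lambda_neq0 i hu; have Fj := Fpp_lambda_neq0 j hu.
have l0 := lambda_neq hu ji.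
have F0 : (Fpp (of_critval (critval u))).[lambda i (of_critval (critval u))] != 0.
  by rewrite of_critvalK.
apply: (near_eq_is_derive (f := fun r =>
  ((Fpp (of_critval r)).[lambda i (of_critval r)])^-1 : R^o)).
  by have := near_of_critval_hyperbolic hu; apply: filterS => r [hr _]; rewrite /= pdr_coord1.
apply: DeriveDef; first exact: derivableV.
rewrite deriveV // D2 of_critvalK // -[_ *: _]/(_ * _); field.
by rewrite Fi Fj l0.
Qed.

Lemma is_derive_G u i j : u \in @hyperbolic R n -> j != i ->
  is_derive (critval u) (delta_mx 0 j : 'rV[R]_n)
    (G n0 i \o @of_critval R n : _ -> R^o)
    (- (((Fpp u).[lambda j u])^-1 / (lambda i u - lambda j u) ^+ 2)).
Proof.
move=> hu ji; have D := is_derive_Fpp hu ji.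
have Fi := Fpp_lambda_neq0 i hu; have Fj := Fpp_lambda_neq0 j hu.
have l0 := lambda_neq hu ji.
have F0 : (Fpp (of_critval (critval u))).[lambda i (of_critval (critval u))] != 0.
  by rewrite of_critvalK.
apply: (near_eq_is_derive (f := fun r =>
  ln `|(Fpp (of_critval r)).[lambda i (of_critval r)]| * 2^-1 : R^o)).
  have := near_of_critval_hyperbolic hu; apply: filterS => r [hr _].
  by rewrite /= G_hyperbolic // mulrC.
have := is_derive_scale 2^-1 (is_derive_ln_norm
  (f := fun r => (Fpp (of_critval r)).[lambda i (of_critval r)] : R^o) F0 D).
rewrite of_critvalK //; congr is_derive; field.
by rewrite Fi Fj l0.
Qed.

End PartialDerivatives.

Theorem corollary2p3 (R : realType) (n : nat) (hn : (2 <= n)%N) :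
  let u1 : 'rV[R]_n -> R := coord1 (ltnW hn) in
  forall (u : 'rV[R]_n) (i : 'I_n), u \in @hyperbolic R n ->
  [/\ pdr_exists i u1 u,
      (Fpp u).[lambda i u] * pdr i u1 u = 1,
      G (ltnW hn) i u = 2^-1 * ln `|(Fpp u).[lambda i u]|
    & forall j : 'I_n, j != i ->
      [/\ [/\ pdr_exists j (G (ltnW hn) i) u,
              pdr_exists j (pdr i u1) u
            & pdr_exists j (lambda i) u],
          pdr j (G (ltnW hn) i) u
            = - (pdr j (pdr i u1) u / (2 * pdr i u1 u)),
          - (pdr j (pdr i u1) u / (2 * pdr i u1 u))
            = - (pdr j u1 u / (lambda i u - lambda j u) ^+ 2)
        & - (pdr j u1 u / (lambda i u - lambda j u) ^+ 2)
            = pdr j (lambda i) u / (lambda i u - lambda j u)]].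
Proof.
move=> u1 u i hu; have Fi := Fpp_lambda_neq0 i hu; split.
- by case: (is_derive_coord1 (ltnW hn) i hu).
- by rewrite pdr_coord1 // mulfV.
- exact: G_hyperbolic.
move=> j ji; have Fj := Fpp_lambda_neq0 j hu; have l0 := lambda_neq hu ji.
have [DG EG] := is_derive_G (ltnW hn) hu ji.
have [DU EU] := is_derive_pdr_coord1 (ltnW hn) hu ji.
have [DL EL] := is_derive_lambda hu ji.
have {}EG : pdr j (G (ltnW hn) i) u = _ := EG.
have {}EU : pdr j (pdr i u1) u = _ := EU.
have {}EL : pdr j (lambda i) u = _ := EL.
have Ei : pdr i u1 u = _ := pdr_coord1 (ltnW hn) i hu.
have Ej : pdr j u1 u = _ := pdr_coord1 (ltnW hn) j hu.
split=> //; rewrite ?EG ?EU ?EL ?Ei ?Ej; field; by rewrite ?Fi ?Fj ?l0.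
Qed.
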